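(* Let $0<a<1$, and let $f_0\in C^1[0,a]$, $f_1\in C^1[a,1]$ satisfy: $f_0(0)=0$, $f_0'(0)<0$, $f_1(1)=0$, $f_1'(1)<0$; $f_0(u)<0$ for $u\in(0,a]$ and $f_1(u)>0$ for $u\in[a,1)$; and $\int_0^a f_0(u)\,du+\int_a^1 f_1(u)\,du>0$. Let $f(u)=f_0(u)$ on $[0,a]$ and $f(u)=f_1(u)$ on $[a,1]$. Then there exists a positive constant $c^*$ such that the equation $u_t=u_{xx}+f(u)$ has a unique $C^1$ travelling wave solution $u^*(x+c^*t)$ with positive speed $c^*$, where $\check c\le c^*\le\hat c$.
   Context: A $C^1$ travelling wave solution with speed $c$ is a solution $u(x,t)=u(z)$, $z=x+ct$, whose profile $u:\mathbb{R}\to[0,1]$ is $C^1$ and satisfies $$u_{zz}-cu_z+f(u)=0,\qquad u(0)=a,\quad u(-\infty)=0,\quad u(+\infty)=1.$$ Since $f_0(a)<0<f_1(a)$, $f$ jumps at $u=a$; the equation is understood at the points $z$ where $u(z)\neq a$. Let (quotients at $u=0$ and $u=1$ being understood as limits) $$\underline{\alpha}=\inf_{u\in[0,a]}\frac{f_0(u)}{u},\quad \overline{\alpha}=\sup_{u\in[0,a]}\frac{f_0(u)}{u},\quad \underline{\beta}=\inf_{u\in[a,1]}\frac{f_1(u)}{u-1},\quad \overline{\beta}=\sup_{u\in[a,1]}\frac{f_1(u)}{u-1},$$ all of which are finite and negative, and let $$\underline{\lambda}_0^+(c)=\tfrac{c+\sqrt{c^2-4\underline{\alpha}}}{2},\quad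 \overline{\lambda}_0^+(c)=\tfrac{c+\sqrt{c^2-4\overline{\alpha}}}{2},\quad \underline{\lambda}_1^-(c)=\tfrac{c-\sqrt{c^2-4\underline{\beta}}}{2},\quad \overline{\lambda}_1^-(c)=\tfrac{c-\sqrt{c^2-4\overline{\beta}}}{2}.$$ The numbers $\check c$ and $\hat c$ are the values of $c$ determined by $$a=\frac{\overline{\lambda}_1^-(\check c)}{\overline{\lambda}_1^-(\check c)-\underline{\lambda}_0^+(\check c)},\qquad a=\frac{\underline{\lambda}_1^-(\hat c)}{\underline{\lambda}_1^-(\hat c)-\overline{\lambda}_0^+(\hat c)}.$$ *)

(* Defs.v *)
From Stdlib Require Import Reals.
From Coquelicot Require Import Coquelicot.

Open Scope R_scope.

(* [df] is the derivative of [f] relative to [lo, hi] (one-sided at the end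
   points); the values of [f] outside [lo, hi] play no role. *)
Definition C1_on (lo hi : R) (f df : R -> R) : Prop :=
  (forall x, lo <= x <= hi ->
     filterdiff f (within (fun y => lo <= y <= hi) (locally x))
                (fun h => scal h (df x))) /\
  continuous_on (fun y => lo <= y <= hi) df.

(* The value chosen at [u = a] is immaterial: the equations below are only
   imposed where [u <> a]. *)
Definition glue (a : R) (f0 f1 : R -> R) (u : R) : R :=
  if Rle_dec u a then f0 u else f1 u.

(* The set of values of f(u)/(u-p), u in [lo, hi], where the quotient at
   [u = p] stands for its limit as [u] tends to [p] within [lo, hi]. *)
Definition quotients (lo hi : R) (f : R -> R) (p : R) : R -> Prop := fun q =>
  (exists u, lo <= u <= hi /\ u <> p /\ q = f u / (u - p)) \/
  filterlim (fun u => f u / (u - p))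
            (within (fun u => lo <= u <= hi) (locally' p)) (locally q).

Definition alpha_inf (a : R) (f0 : R -> R) : R :=
  real (Glb_Rbar (quotients 0 a f0 0)).
Definition alpha_sup (a : R) (f0 : R -> R) : R :=
  real (Lub_Rbar (quotients 0 a f0 0)).
Definition beta_inf (a : R) (f1 : R -> R) : R :=
  real (Glb_Rbar (quotients a 1 f1 1)).
Definition beta_sup (a : R) (f1 : R -> R) : R :=
  real (Lub_Rbar (quotients a 1 f1 1)).

Definition lambda_plus (k c : R) : R := (c + sqrt (c ^ 2 - 4 * k)) / 2.
Definition lambda_minus (k c : R) : R := (c - sqrt (c ^ 2 - 4 * k)) / 2.

Definition speed_eq (a alpha beta c : R) : Prop :=
  a = lambda_minus beta c / (lambda_minus beta c - lambda_plus alpha c).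

Definition is_c_check (a : R) (f0 f1 : R -> R) : R -> Prop :=
  unique (speed_eq a (alpha_inf a f0) (beta_sup a f1)).
Definition is_c_hat (a : R) (f0 f1 : R -> R) : R -> Prop :=
  unique (speed_eq a (alpha_sup a f0) (beta_inf a f1)).

(* U_t = U_xx + f(U) wherever [U <> a]. *)
Definition solves_rd (a : R) (f : R -> R) (U : R -> R -> R) : Prop :=
  forall x t, U x t <> a ->
    ex_derive (fun s => U x s) t /\ ex_derive_n (fun y => U y t) 2 x /\
    Derive (fun s => U x s) t = Derive_n (fun y => U y t) 2 x + f (U x t).

Record travelling_wave (a : R) (f : R -> R) (c : R) (u : R -> R) : Prop := {
  tw_pde : solves_rd a f (fun x t => u (x + c * t));
  tw_range : forall z, 0 <= u z <= 1;
  tw_derivable : forall z, ex_derive u z;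
  tw_C1 : forall z, continuous (Derive u) z;
  tw_ode : forall z, u z <> a ->
    ex_derive_n u 2 z /\ Derive_n u 2 z - c * Derive u z + f (u z) = 0;
  tw_origin : u 0 = a;
  tw_minus_infty : is_lim u m_infty 0;
  tw_plus_infty : is_lim u p_infty 1
}.

(* Main.v *)
Require Import Defs.
From Stdlib Require Import Reals Lra Lia.
From Coquelicot Require Import Coquelicot.

Open Scope R_scope.

(* Along a wave, [p = u'] as a function of [u] solves [p p' = c p - f] and vanishes at
   [u = 0] and [u = 1]. In terms of the distance [y] to the end state, either half reads
   [p p' = C p + g y * y] with [g > 0] and [C = c] near [0], [C = - c] near [1]. It has a
   unique solution with [p 0 = 0 < p], squeezed between the lines of slope [Lam lo C] and
   [Lam hi C] where [lo <= g <= hi], and increasing in [C]. A wave of speed [c] exists iff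
   the two halves agree at [u = a]; their mismatch there is increasing in [c], is
   [<= 0] at [c_check] and [>= 0] at [c_hat] by the linear bounds, and is negative at
   [c = 0] because [f] has positive integral. *)

(** * Real analysis *)

(** Two obstacles shape the proof. The equation [p p' = C p + g y * y] is singular at the end state,
    where [p] vanishes, so standard existence theorems do not start there. Writing [p = y * sqrt r]
    and integrating against a power of [y] gives a fixed point problem that is regular at [y = 0];
    the two bounding lines become a constant subsolution and supersolution, and the power is taken
    so high that the map is monotone even for negative [C]. The other obstacle is that a wave is not
    assumed monotone, so a priori it is not a curve over [u]. Up to its first passage at [a] it lies
    on the branch, because the deviation from the branch shrinks as [z] grows and hence vanishes for
    an orbit that comes from the saddle. For [c > 0] an energy argument forbids a return to [a], and
    a reflection treats the other half. The passage between waves and phase curves goes through the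
    logit of [u], which obeys an autonomous equation whose right-hand side is continuous and stays
    between positive constants. *)

Lemma continuous_eps (f : R -> R) (x : R) :
  continuous f x <->
  forall eps, 0 < eps -> exists delta, 0 < delta /\
    forall y, Rabs (y - x) < delta -> Rabs (f y - f x) < eps.
Proof.
  split.
  - intros H eps He.
    apply continuity_pt_filterlim in H.
    destruct (H eps He) as [d [Hd H']].
    exists d; split; [exact Hd|].
    intros y Hy.
    destruct (Req_dec y x) as [->|n].
    + replace (f x - f x) with 0 by ring. now rewrite Rabs_R0.
    + apply (H' y). split.
      * split; [exact I | now apply not_eq_sym].
      * exact Hy.
  - intros H. apply continuity_pt_filterlim.
    intros eps He. destruct (H eps He) as [d [Hd H']].
    exists d; split; [exact Hd|].
    intros y [_ Hy]. now apply H'.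
Qed.

Lemma continuous_continuity (f : R -> R) :
  (forall x, continuous f x) -> continuity f.
Proof. intros H x. now apply continuity_pt_filterlim, H. Qed.

Lemma is_derive_continuous (f : R -> R) (x l : R) :
  is_derive f x l -> continuous f x.
Proof.
  intros H. apply (ex_derive_continuous (K := R_AbsRing) (V := R_NormedModule)).
  now exists l.
Qed.

Lemma Rmin_continuous (a x : R) : continuous (fun y => Rmin y a) x.
Proof.
  apply continuous_eps; intros eps He; exists eps; split; [exact He|].
  intros y. unfold Rmin.
  destruct (Rle_dec y a), (Rle_dec x a); unfold Rabs;
    repeat destruct Rcase_abs; lra.
Qed.

Lemma Rmax_continuous (a x : R) : continuous (fun y => Rmax y a) x.
Proof.
  apply continuous_eps; intros eps He; exists eps; split; [exact He|].
  intros y. unfold Rmax.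
  destruct (Rle_dec y a), (Rle_dec x a); unfold Rabs;
    repeat destruct Rcase_abs; lra.
Qed.

Lemma mean_value (f df : R -> R) (a b : R) :
  a < b ->
  (forall x, a < x < b -> is_derive f x (df x)) ->
  (forall x, a <= x <= b -> continuous f x) ->
  exists c, a < c < b /\ f b - f a = df c * (b - a).
Proof.
  intros Hab Hd Hc.
  assert (pr1 : forall c, a < c < b -> derivable_pt f c).
  { intros c Hcc. exists (df c). now apply is_derive_Reals, Hd. }
  assert (pr2 : forall c, a < c < b -> derivable_pt id c)
    by (intros; apply derivable_pt_id).
  destruct (MVT f id a b pr1 pr2 Hab) as [c [P E]].
  - intros x Hx. now apply continuity_pt_filterlim, Hc.
  - intros x Hx. apply derivable_continuous_pt, derivable_pt_id.
  - exists c; split; [exact P|].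
    rewrite (derive_pt_eq_0 f c (df c)) in E by now apply is_derive_Reals, Hd.
    rewrite (derive_pt_eq_0 id c 1) in E by apply derivable_pt_lim_id.
    unfold id in E. lra.
Qed.

Lemma nondecreasing_of_derive (f df : R -> R) (a b : R) :
  a <= b ->
  (forall x, a < x < b -> is_derive f x (df x)) ->
  (forall x, a <= x <= b -> continuous f x) ->
  (forall x, a < x < b -> 0 <= df x) ->
  f a <= f b.
Proof.
  intros [Hab| ->] Hd Hc Hp; [|lra].
  destruct (mean_value f df a b Hab Hd Hc) as [c [Hcc E]].
  specialize (Hp c Hcc). nra.
Qed.

Lemma increasing_of_derive (f df : R -> R) (a b : R) :
  a < b ->
  (forall x, a < x < b -> is_derive f x (df x)) ->
  (forall x, a <= x <= b -> continuous f x) ->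
  (forall x, a < x < b -> 0 < df x) ->
  f a < f b.
Proof.
  intros Hab Hd Hc Hp.
  destruct (mean_value f df a b Hab Hd Hc) as [c [Hcc E]].
  specialize (Hp c Hcc). nra.
Qed.

Lemma derive_pos_local (f : R -> R) (x l : R) :
  is_derive f x l -> 0 < l ->
  exists delta, 0 < delta /\
    forall y, Rabs (y - x) < delta -> y <> x -> 0 < (f y - f x) * (y - x).
Proof.
  intros Hd Hl. apply is_derive_Reals in Hd.
  destruct (Hd l Hl) as [d Hd']. exists d; split; [apply cond_pos|].
  intros y Hy n. specialize (Hd' (y - x)).
  replace (x + (y - x)) with y in Hd' by ring.
  apply Rabs_def2 in Hd'; [|lra|exact Hy].
  assert (0 < (f y - f x) / (y - x)) by lra.
  replace ((f y - f x) * (y - x))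
    with ((f y - f x) / (y - x) * (y - x) ^ 2) by (field; lra).
  apply Rmult_lt_0_compat; [assumption|]. apply pow2_gt_0. lra.
Qed.

(** The intermediate value theorem gives some zero; the supremum of the initial stretches on which
    [g] is negative gives the first one. *)
Lemma first_zero (g : R -> R) (x1 x2 : R) :
  (forall x, continuous g x) -> x1 <= x2 -> g x1 < 0 -> 0 <= g x2 ->
  exists z, x1 < z <= x2 /\ g z = 0 /\ forall y, x1 <= y < z -> g y < 0.
Proof.
  intros Hc Hx H1 H2.
  set (E := fun t => x1 <= t <= x2 /\ forall y, x1 <= y <= t -> g y < 0).
  destruct (completeness E) as [z [Hub Hlub]].
  - exists x2. intros t [Ht _]. lra.
  - exists x1. split; [lra|]. intros y Hy. now replace y with x1 by lra.
  - assert (Ez : x1 <= z).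
    { apply Hub. split; [lra|]. intros y Hy. now replace y with x1 by lra. }
    assert (Ez2 : z <= x2) by (apply Hlub; intros t [Ht _]; lra).
    assert (Hneg : forall y, x1 <= y < z -> g y < 0).
    { intros y Hy. destruct (Rlt_dec (g y) 0) as [|n]; [assumption|exfalso].
      assert (z <= y); [|lra].
      apply Hlub. intros t [Ht Ht']. destruct (Rle_dec t y); [assumption|].
      exfalso. apply n, Ht'. lra. }
    destruct (Rtotal_order (g z) 0) as [Hz|[Hz|Hz]].
    + exfalso.
      destruct (proj1 (continuous_eps g z) (Hc z) (- g z)) as [d [Hd H']]; [lra|].
      assert (zx : z < x2) by (destruct Ez2 as [|e]; [assumption|rewrite e in Hz; lra]).
      pose proof (Rmin_l (z + d / 2) x2). pose proof (Rmin_r (z + d / 2) x2).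
      set (t := Rmin (z + d / 2) x2) in *.
      assert (z < t) by (unfold t; apply Rmin_glb_lt; lra).
      assert (t <= z); [|lra].
      apply Hub. split; [lra|]. intros y Hy.
      destruct (Rlt_dec y z); [apply Hneg; lra|].
      assert (Hy' : Rabs (y - z) < d) by (apply Rabs_def1; lra).
      specialize (H' y Hy'). apply Rabs_def2 in H'. lra.
    + exists z. split; [|now split].
      split; [|assumption]. destruct Ez as [|e]; [assumption|]. rewrite <- e in Hz. lra.
    + exfalso.
      destruct (proj1 (continuous_eps g z) (Hc z) (g z)) as [d [Hd H']]; [lra|].
      assert (x1 < z) by (destruct Ez as [|e]; [assumption|rewrite <- e in Hz; lra]).
      pose proof (Rmax_l (z - d / 2) x1). pose proof (Rmax_r (z - d / 2) x1).
      set (t := Rmax (z - d / 2) x1) in *.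
      assert (t < z) by (unfold t; apply Rmax_lub_lt; lra).
      assert (g t < 0) by (apply Hneg; lra).
      assert (Hy' : Rabs (t - z) < d) by (apply Rabs_def1; lra).
      specialize (H' t Hy'). apply Rabs_def2 in H'. lra.
Qed.

Lemma last_zero (g : R -> R) (x1 x2 : R) :
  (forall x, continuous g x) -> x1 <= x2 -> 0 <= g x1 -> g x2 < 0 ->
  exists z, x1 <= z < x2 /\ g z = 0 /\ forall y, z < y <= x2 -> g y < 0.
Proof.
  intros Hc Hx H1 H2.
  destruct (first_zero (fun x => g (- x)) (- x2) (- x1)) as [z [Hz [E Hn]]].
  - intros x. apply (continuous_comp Ropp g); [|apply Hc].
    apply (continuous_opp (K := R_AbsRing) (V := R_NormedModule)), continuous_id.
  - lra.
  - now rewrite Ropp_involutive.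
  - now rewrite Ropp_involutive.
  - exists (- z). split; [lra|]. split; [exact E|].
    intros y Hy. rewrite <- (Ropp_involutive y). apply Hn. lra.
Qed.

(** A barrier principle: if [D Y] were negative, then from its last zero up to [Y] the function
    would be negative, hence nondecreasing. Derivatives are taken at [0 < y] only, since the
    equation of a branch is singular at 0. *)
Lemma nonneg_of_derive_where_neg (D dD : R -> R) (Y : R) :
  (forall x, continuous D x) -> 0 <= D 0 ->
  (forall y, 0 < y -> is_derive D y (dD y)) ->
  (forall y, 0 < y -> D y < 0 -> 0 <= dD y) ->
  0 <= Y -> 0 <= D Y.
Proof.
  intros Hc H0 Hd Hb HY.
  destruct (Rle_dec 0 (D Y)) as [|n]; [assumption|exfalso].
  destruct (last_zero D 0 Y Hc HY H0) as [z [Hz [E Hn]]]; [lra|].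
  assert (D z <= D Y); [|lra].
  apply (nondecreasing_of_derive D dD); intros.
  - lra.
  - apply Hd; lra.
  - apply Hc.
  - apply Hb; [lra|]. apply Hn; lra.
Qed.

Lemma is_derive_RInt_cont (f : R -> R) (a x : R) :
  (forall y, continuous f y) -> is_derive (fun y => RInt f a y) x (f x).
Proof.
  intros Hc. apply (is_derive_RInt f (fun y => RInt f a y) a x); [|apply Hc].
  apply filter_forall. intros b. apply (RInt_correct (V := R_CompleteNormedModule)).
  apply (ex_RInt_continuous (V := R_CompleteNormedModule)). intros; apply Hc.
Qed.

Lemma is_derive_inverse (f g : R -> R) (y l : R) :
  is_derive f (g y) l -> l <> 0 -> (forall s, f (g s) = s) -> continuous g y ->
  is_derive g y (/ l).
Proof.
  intros Hf Hl Hfg Hg.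
  (* The difference quotients of [g] at [y] are the values of [/ phi] along [g]. *)
  set (phi := fun x => if Req_dec_T x (g y) then l else (f x - f (g y)) / (x - g y)).
  assert (Hphi : continuous phi (g y)).
  { apply continuous_eps. intros eps He. apply is_derive_Reals in Hf.
    destruct (Hf eps He) as [d Hd]. exists d; split; [apply cond_pos|].
    intros x Hx. unfold phi at 2. destruct (Req_dec_T (g y) (g y)) as [_|]; [|easy].
    unfold phi. destruct (Req_dec_T x (g y)) as [_|n].
    - replace (l - l) with 0 by ring. now rewrite Rabs_R0.
    - specialize (Hd (x - g y)). replace (g y + (x - g y)) with x in Hd by ring.
      apply Hd; [lra|exact Hx]. }
  assert (Hpg : continuous (fun s => / phi (g s)) y).
  { apply (continuous_comp (fun s => phi (g s)) Rinv).
    - now apply continuous_comp.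
    - unfold phi. destruct (Req_dec_T (g y) (g y)) as [_|]; [|easy].
      now apply continuous_Rinv. }
  apply is_derive_Reals. intros eps He.
  destruct (proj1 (continuous_eps _ _) Hpg eps He) as [d [Hd H']].
  exists (mkposreal d Hd). simpl. intros h Hh Hhd.
  specialize (H' (y + h)). replace (y + h - y) with h in H' by ring.
  specialize (H' Hhd). unfold phi in H'.
  destruct (Req_dec_T (g y) (g y)) as [_|]; [|easy].
  destruct (Req_dec_T (g (y + h)) (g y)) as [e|n].
  - exfalso. apply Hh. assert (y + h = y); [|lra].
    rewrite <- (Hfg (y + h)), e. apply Hfg.
  - rewrite !Hfg in H'.
    replace ((g (y + h) - g y) / h) with (/ ((y + h - y) / (g (y + h) - g y))); [exact H'|].
    replace (y + h - y) with h by ring. field. split; [exact Hh|lra].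
Qed.

(** * The branch of the phase curve leaving a saddle *)

(** The positive root of [x ^ 2 = c * x + g]: for constant [g] it is the unstable eigenvalue of the
    saddle, and [p = Lam g c * y] is the exact phase curve. *)
Definition Lam (g c : R) : R := (c + sqrt (c ^ 2 + 4 * g)) / 2.

Lemma Lam_spec (g c : R) : 0 < g ->
  0 < Lam g c /\ c < Lam g c /\ Lam g c ^ 2 = c * Lam g c + g.
Proof.
  intros Hg. unfold Lam.
  assert (0 <= c ^ 2 + 4 * g) by nra.
  pose proof (sqrt_sqrt (c ^ 2 + 4 * g) H) as E.
  pose proof (sqrt_pos (c ^ 2 + 4 * g)) as P.
  set (s := sqrt (c ^ 2 + 4 * g)) in *.
  assert (Rabs c < s).
  { apply Rsqr_incrst_0; [|apply Rabs_pos|exact P].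
    rewrite <- Rsqr_abs. unfold Rsqr. nra. }
  assert (-s < c < s) by (split; [|]; apply Rabs_def2 in H0; lra).
  repeat split; [lra|lra|]. nra.
Qed.

Lemma Lam_unique (g c x : R) : 0 < g -> 0 < x -> x ^ 2 = c * x + g -> x = Lam g c.
Proof.
  intros Hg Hx E. destruct (Lam_spec g c Hg) as [Hp [_ E']].
  set (y := Lam g c) in *.
  (* Eliminating [c] from the two quadratic equations leaves this product, whose second factor is
     positive. *)
  assert ((x - y) * (x * y + g) = 0).
  { replace ((x - y) * (x * y + g))
      with (y * (x ^ 2 - c * x - g) - x * (y ^ 2 - c * y - g)) by ring.
    rewrite E, E'. ring. }
  apply Rmult_integral in H. destruct H; nra.
Qed.

Lemma Lam_mono (g1 g2 c : R) : g1 <= g2 -> Lam g1 c <= Lam g2 c.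
Proof.
  intros H. unfold Lam. assert (sqrt (c ^ 2 + 4 * g1) <= sqrt (c ^ 2 + 4 * g2)); [|lra].
  apply sqrt_le_1_alt. lra.
Qed.

(** * Weighted averages over [[0, y]] *)

(** For [y <> 0] this is the integral of [s ^ S k * G s] over [[0, y]] divided by [y ^ (k + 2)];
    rescaling to [[0, 1]] gives it a meaning at [y = 0] as well. The weight has total mass
    [1 / (k + 2)]. *)
Definition average (k : nat) (G : R -> R) (y : R) : R :=
  RInt (fun t => t ^ S k * G (y * t)) 0 1.

Lemma average_integrand_continuous (k : nat) (G : R -> R) (y t : R) :
  (forall x, continuous G x) -> continuous (fun t => t ^ S k * G (y * t)) t.
Proof.
  intros HG.
  apply (continuous_mult (K := R_AbsRing) (fun t => t ^ S k) (fun t => G (y * t))).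
  - eapply is_derive_continuous. auto_derive; [easy|reflexivity].
  - apply (continuous_comp (fun t => y * t) G); [|apply HG].
    apply (is_derive_continuous _ _ y). auto_derive; [easy|ring].
Qed.

Lemma average_ex (k : nat) (G : R -> R) (y : R) :
  (forall x, continuous G x) -> ex_RInt (fun t => t ^ S k * G (y * t)) 0 1.
Proof.
  intros HG. apply (ex_RInt_continuous (V := R_CompleteNormedModule)).
  intros t _. now apply average_integrand_continuous.
Qed.

Lemma average_le (k : nat) (G1 G2 : R -> R) (y : R) :
  (forall x, continuous G1 x) -> (forall x, continuous G2 x) ->
  (forall t, 0 < t < 1 -> G1 (y * t) <= G2 (y * t)) ->
  average k G1 y <= average k G2 y.
Proof.
  intros H1 H2 H. apply RInt_le; [lra|now apply average_ex|now apply average_ex|].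
  intros t Ht. apply Rmult_le_compat_l; [apply pow_le; lra|now apply H].
Qed.

Lemma average_const (k : nat) (m y : R) : average k (fun _ => m) y = m / INR (k + 2).
Proof.
  assert (P : INR (k + 2) <> 0) by (apply not_0_INR; lia).
  unfold average. apply is_RInt_unique.
  replace (m / INR (k + 2))
    with (minus (m * 1 ^ (k + 2) / INR (k + 2)) (m * 0 ^ (k + 2) / INR (k + 2))).
  2:{ unfold minus, plus, opp; simpl. rewrite pow1, pow_i by lia. field. exact P. }
  apply (is_RInt_derive (fun t => m * t ^ (k + 2) / INR (k + 2))).
  - intros t _. auto_derive; [easy|].
    replace (pred (k + 2)) with (S k) by lia. field. exact P.
  - intros t _. apply (average_integrand_continuous k (fun _ => m) 0).
    intros; apply continuous_const.
Qed.

Lemma average_plus_const (k : nat) (G : R -> R) (m y : R) :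
  (forall x, continuous G x) ->
  average k (fun s => G s + m) y = average k G y + m / INR (k + 2).
Proof.
  intros HG. rewrite <- (average_const k m y). unfold average.
  rewrite <- (RInt_plus (V := R_CompleteNormedModule)).
  - apply RInt_ext. intros t _. unfold plus; simpl. ring.
  - now apply average_ex.
  - apply (average_ex k (fun _ => m) y). intros; apply continuous_const.
Qed.

Lemma average_continuous (k : nat) (G : R -> R) (y0 : R) :
  (forall x, continuous G x) -> continuous (average k G) y0.
Proof.
  intros HG. apply continuous_eps. intros eps He.
  set (b := Rabs y0 + 1). pose proof (Rabs_pos y0).
  assert (HG' : forall x, - b <= x <= b -> continuity_pt G x)
    by (intros x _; now apply continuity_pt_filterlim, HG).
  destruct (Heine_cor2 HG' (mkposreal eps He)) as [d Hd].
  exists (Rmin d 1). split; [apply Rmin_glb_lt; [apply cond_pos|lra]|].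
  intros y Hy.
  assert (Hy1 : Rabs (y - y0) < d) by (eapply Rlt_le_trans; [exact Hy|apply Rmin_l]).
  assert (Hy2 : Rabs (y - y0) < 1) by (eapply Rlt_le_trans; [exact Hy|apply Rmin_r]).
  assert (Hc : forall z x, continuous (fun x => G (z * x)) x).
  { intros z x. apply (continuous_comp (fun x => z * x) G); [|apply HG].
    apply (is_derive_continuous _ _ z). auto_derive; [easy|ring]. }
  assert (Hclose : forall t, 0 < t < 1 -> Rabs (G (y * t) - G (y0 * t)) < eps).
  { intros t Ht.
    assert (Hb : forall z, Rabs z <= b -> - b <= z * t <= b).
    { intros z Hz. apply Rabs_le_between in Hz. nra. }
    apply Hd.
    - apply Hb. unfold b. replace y with ((y - y0) + y0) by ring.
      pose proof (Rabs_triang (y - y0) y0). lra.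
    - apply Hb. unfold b. lra.
    - replace (y * t - y0 * t) with ((y - y0) * t) by ring.
      rewrite Rabs_mult, (Rabs_pos_eq t) by lra.
      pose proof (Rabs_pos (y - y0)). nra. }
  (* [average_le] compares two functions at one point. Moving [z] from the point into the function
     makes it apply to one function at two points. *)
  assert (Hswap : forall z, average k G z = average k (fun t => G (z * t)) 1).
  { intros z. apply RInt_ext. intros t _. now rewrite Rmult_1_l. }
  assert (Hk : 2 <= INR (k + 2)).
  { rewrite plus_INR. pose proof (pos_INR k). simpl. lra. }
  assert (Hstrict : eps / INR (k + 2) < eps).
  { apply Rmult_lt_reg_r with (INR (k + 2)); [lra|].
    unfold Rdiv. rewrite Rmult_assoc, Rinv_l by lra. nra. }
  rewrite !Hswap.
  assert (A1 : average k (fun t => G (y * t)) 1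
               <= average k (fun t => G (y0 * t) + eps) 1).
  { apply average_le.
    - intros x; apply Hc.
    - intros x; apply (continuous_plus (V := R_NormedModule)); [apply Hc|apply continuous_const].
    - intros t Ht. rewrite Rmult_1_l. pose proof (Hclose t Ht) as Q.
      apply Rabs_def2 in Q. lra. }
  assert (A2 : average k (fun t => G (y0 * t)) 1
               <= average k (fun t => G (y * t) + eps) 1).
  { apply average_le.
    - intros x; apply Hc.
    - intros x; apply (continuous_plus (V := R_NormedModule)); [apply Hc|apply continuous_const].
    - intros t Ht. rewrite Rmult_1_l. pose proof (Hclose t Ht) as Q.
      apply Rabs_def2 in Q. lra. }
  rewrite average_plus_const in A1 by (intros; apply Hc).
  rewrite average_plus_const in A2 by (intros; apply Hc).
  apply Rabs_def1; lra.
Qed.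

Lemma average_scaled (k : nat) (G : R -> R) (y : R) :
  (forall x, continuous G x) ->
  y ^ (k + 2) * average k G y = RInt (fun s => s ^ S k * G s) 0 y.
Proof.
  intros HG. unfold average.
  pose proof (RInt_comp_lin (V := R_CompleteNormedModule)
                (fun s => s ^ S k * G s) y 0 0 1) as E.
  replace (y * 0 + 0) with 0 in E by ring. replace (y * 1 + 0) with y in E by ring.
  rewrite <- E.
  - rewrite <- (RInt_scal (V := R_CompleteNormedModule)) by now apply average_ex.
    apply RInt_ext. intros t _. unfold scal; simpl; unfold mult; simpl.
    rewrite Rplus_0_r, Rpow_mult_distr. replace (k + 2)%nat with (S (S k)) by lia.
    simpl. ring.
  - apply (ex_RInt_continuous (V := R_CompleteNormedModule)). intros s _.
    apply (continuous_ext (fun t => t ^ S k * G (1 * t))).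
    + intros t. now rewrite Rmult_1_l.
    + now apply average_integrand_continuous.
Qed.

(** * The fixed point equation of the branch *)

Definition source (k : nat) (c r : R) : R := INR k * r / 2 + c * sqrt r.

(* Writing [p p' = c p + g y] with [p = y sqrt r], adding [k p ^ 2 / (2 y)] to both
   sides and integrating against [y ^ k] turns the equation into [r = step k c g r].
   The exponent [k] makes [source] monotone even when [c < 0]. *)
Definition step (k : nat) (c : R) (g r : R -> R) (y : R) : R :=
  2 * average k (fun s => source k c (r s) + g s) y.

(** The derivative of [source] in [r] is [INR k / 2 + c / (2 * sqrt r)]. Where [sqrt r >= l], the
    condition [0 <= INR k * l + c] makes it nonnegative and [c <= l] bounds it by
    [(INR k + 1) / 2]. *)
Lemma source_mono (k : nat) (c l r1 r2 : R) :
  0 < l -> c <= l -> 0 <= INR k * l + c -> l ^ 2 <= r1 -> r1 <= r2 ->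
  0 <= source k c r2 - source k c r1 <= (INR k + 1) / 2 * (r2 - r1).
Proof.
  intros Hl Hcl Hk H1 H2. unfold source.
  assert (0 < l ^ 2) by nra.
  pose proof (sqrt_sqrt r1 ltac:(lra)) as E1.
  pose proof (sqrt_sqrt r2 ltac:(lra)) as E2.
  pose proof (sqrt_le_1_alt _ _ H1) as L1.
  pose proof (sqrt_le_1_alt _ _ H2) as L2.
  rewrite sqrt_pow2 in L1 by lra.
  pose proof (pos_INR k).
  set (s1 := sqrt r1) in *. set (s2 := sqrt r2) in *.
  rewrite <- E1, <- E2.
  replace (INR k * (s2 * s2) / 2 + c * s2 - (INR k * (s1 * s1) / 2 + c * s1))
    with ((s2 - s1) * (INR k * (s1 + s2) / 2 + c)) by field.
  replace ((INR k + 1) / 2 * (s2 * s2 - s1 * s1))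
    with ((s2 - s1) * ((INR k + 1) * (s1 + s2) / 2)) by field.
  split.
  - apply Rmult_le_pos; [lra|]. nra.
  - apply Rmult_le_compat_l; [lra|]. nra.
Qed.

Lemma source_continuous (k : nat) (c : R) (g r : R -> R) (y : R) :
  continuous g y -> continuous r y ->
  continuous (fun s => source k c (r s) + g s) y.
Proof.
  intros Hg Hr. unfold source.
  apply (continuous_plus (V := R_NormedModule) (fun s => INR k * r s / 2 + c * sqrt (r s)) g);
    [|exact Hg].
  apply (continuous_plus (V := R_NormedModule)
           (fun s => INR k * r s / 2) (fun s => c * sqrt (r s))).
  - apply (continuous_comp r (fun x => INR k * x / 2)); [exact Hr|].
    apply (is_derive_continuous _ _ (INR k / 2)). auto_derive; [easy|field].
  - apply (continuous_comp r (fun x => c * sqrt x)); [exact Hr|].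
    apply (continuous_scal_r (V := R_NormedModule) c). apply continuous_sqrt.
Qed.

Lemma step_continuous (k : nat) (c : R) (g r : R -> R) (y : R) :
  (forall x, continuous g x) -> (forall x, continuous r x) ->
  continuous (step k c g r) y.
Proof.
  intros Hg Hr. apply (continuous_scal_r (V := R_NormedModule) 2).
  apply average_continuous. intros; now apply source_continuous.
Qed.

(** The Lipschitz constant [(INR k + 1) / 2] of [source], times the factor 2 of [step], times the
    mass [1 / (k + 2)] of the weight, is the contraction factor. *)
Lemma step_mono (k : nat) (c l d : R) (g r1 r2 : R -> R) (y : R) :
  (forall x, continuous g x) -> (forall x, continuous r1 x) ->
  (forall x, continuous r2 x) ->
  0 < l -> c <= l -> 0 <= INR k * l + c ->
  (forall x, l ^ 2 <= r1 x) -> (forall x, 0 <= r2 x - r1 x <= d) ->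
  0 <= step k c g r2 y - step k c g r1 y <= (INR k + 1) / (INR k + 2) * d.
Proof.
  intros Hg H1 H2 Hl Hcl Hk Hr1 Hr. unfold step.
  assert (C1 : forall x, continuous (fun s => source k c (r1 s) + g s) x)
    by (intros; now apply source_continuous).
  assert (C2 : forall x, continuous (fun s => source k c (r2 s) + g s) x)
    by (intros; now apply source_continuous).
  set (m := (INR k + 1) / 2 * d).
  pose proof (pos_INR k).
  assert (Hs : forall x, 0 <= source k c (r2 x) - source k c (r1 x) <= m).
  { intros x. destruct (source_mono k c l (r1 x) (r2 x)) as [A B]; auto.
    - specialize (Hr x). lra.
    - split; [exact A|]. eapply Rle_trans; [exact B|]. unfold m.
      apply Rmult_le_compat_l; [lra|]. apply Hr. }
  assert (A1 : average k (fun s => source k c (r1 s) + g s) y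
               <= average k (fun s => source k c (r2 s) + g s) y).
  { apply average_le; auto. intros t _. specialize (Hs (y * t)). lra. }
  assert (A2 : average k (fun s => source k c (r2 s) + g s) y
               <= average k (fun s => source k c (r1 s) + g s + m) y).
  { apply average_le; auto.
    - intros x. apply (continuous_plus (V := R_NormedModule)); [apply C1|apply continuous_const].
    - intros t _. specialize (Hs (y * t)). lra. }
  rewrite (average_plus_const k (fun s => source k c (r1 s) + g s)) in A2 by auto.
  replace ((INR k + 1) / (INR k + 2) * d) with (2 * (m / INR (k + 2))).
  - lra.
  - unfold m. rewrite plus_INR. simpl. field. lra.
Qed.

(** With [l = Lam lo c], the relation [c * l + lo = l ^ 2] bounds the integrand below by
    [(INR k / 2 + 1) * l ^ 2], whose average is [l ^ 2 / 2]. The line of slope [l] thus gives a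
    subsolution. *)
Lemma step_const_lower (k : nat) (c lo : R) (g : R -> R) (y : R) :
  0 < lo -> (forall x, continuous g x) -> (forall x, lo <= g x) ->
  Lam lo c ^ 2 <= step k c g (fun _ => Lam lo c ^ 2) y.
Proof.
  intros Hlo Hc Hg. destruct (Lam_spec lo c Hlo) as [P [_ E]].
  pose proof (pos_INR k) as Hk.
  set (l := Lam lo c) in *. unfold step.
  assert (A : average k (fun _ => (INR k / 2 + 1) * l ^ 2) y
              <= average k (fun s => source k c (l ^ 2) + g s) y).
  { apply average_le.
    - intros; apply continuous_const.
    - intros; apply source_continuous; [apply Hc|apply continuous_const].
    - intros t _. unfold source. rewrite sqrt_pow2 by lra. specialize (Hg (y * t)). lra. }
  rewrite average_const, plus_INR in A. simpl INR in A.
  replace ((INR k / 2 + 1) * l ^ 2 / (INR k + (1 + 1))) with (l ^ 2 / 2) in A by (field; lra).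
  lra.
Qed.

Lemma step_const_upper (k : nat) (c hi : R) (g : R -> R) (y : R) :
  0 < hi -> (forall x, continuous g x) -> (forall x, g x <= hi) ->
  step k c g (fun _ => Lam hi c ^ 2) y <= Lam hi c ^ 2.
Proof.
  intros Hlo Hc Hg. destruct (Lam_spec hi c Hlo) as [P [_ E]].
  pose proof (pos_INR k) as Hk.
  set (l := Lam hi c) in *. unfold step.
  assert (A : average k (fun s => source k c (l ^ 2) + g s) y
              <= average k (fun _ => (INR k / 2 + 1) * l ^ 2) y).
  { apply average_le.
    - intros; apply source_continuous; [apply Hc|apply continuous_const].
    - intros; apply continuous_const.
    - intros t _. unfold source. rewrite sqrt_pow2 by lra. specialize (Hg (y * t)). lra. }
  rewrite average_const, plus_INR in A. simpl INR in A.
  replace ((INR k / 2 + 1) * l ^ 2 / (INR k + (1 + 1))) with (l ^ 2 / 2) in A by (field; lra).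
  lra.
Qed.

(** Monotone iteration from both sides: the iterates [L] rise from the subsolution, the iterates [U]
    descend from the supersolution, and the contraction closes the gap. The bounds by [d] on the
    increments supply the upper bound that [step_mono] asks for. *)
Lemma iterates_spec (k : nat) (c lo hi : R) (g : R -> R) (n : nat) :
  0 < lo -> (forall x, continuous g x) -> (forall x, lo <= g x <= hi) ->
  0 <= INR k * Lam lo c + c ->
  let L n := Nat.iter n (step k c g) (fun _ => Lam lo c ^ 2) in
  let U n := Nat.iter n (step k c g) (fun _ => Lam hi c ^ 2) in
  let d := Lam hi c ^ 2 - Lam lo c ^ 2 in
  (forall x, continuous (L n) x) /\ (forall x, continuous (U n) x) /\
  (forall x, Lam lo c ^ 2 <= L n x) /\
  (forall x, 0 <= U n x - L n x <= ((INR k + 1) / (INR k + 2)) ^ n * d) /\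
  (forall x, 0 <= L (S n) x - L n x <= d) /\
  (forall x, 0 <= U n x - U (S n) x <= d).
Proof.
  intros Hlo Hg Hb Hk L U d.
  destruct (Lam_spec lo c Hlo) as [Pl [Pc _]].
  assert (Hlh : lo <= hi) by (specialize (Hb 0); lra).
  assert (Hll : Lam lo c ^ 2 <= Lam hi c ^ 2).
  { apply pow_incr. split; [lra|]. now apply Lam_mono. }
  pose proof (pos_INR k) as Hkk.
  assert (Hq : 0 <= (INR k + 1) / (INR k + 2) <= 1).
  { split.
    - apply Rmult_le_pos; [lra|]. left. apply Rinv_0_lt_compat. lra.
    - apply Rmult_le_reg_r with (INR k + 2); [lra|]. field_simplify; lra. }
  set (q := (INR k + 1) / (INR k + 2)) in *.
  assert (Hqd : forall e, 0 <= e -> q * e <= e) by (intros; nra).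
  assert (Hd : 0 <= d) by (unfold d; lra).
  assert (Hstep : forall r1 r2 e, (forall x, continuous r1 x) -> (forall x, continuous r2 x) ->
    (forall x, Lam lo c ^ 2 <= r1 x) -> (forall x, 0 <= r2 x - r1 x <= e) -> forall y,
    0 <= step k c g r2 y - step k c g r1 y <= q * e).
  { intros r1 r2 e C1 C2 Hr1 Hr y.
    apply (step_mono k c (Lam lo c) e g r1 r2 y); auto; lra. }
  assert (HL1 : forall x, Lam lo c ^ 2 <= L 1%nat x)
    by (intros; apply step_const_lower; auto; apply Hb).
  assert (HU1 : forall x, U 1%nat x <= Lam hi c ^ 2).
  { intros; apply step_const_upper; [lra|auto|apply Hb]. }
  assert (H01 : forall x, 0 <= U 1%nat x - L 1%nat x <= q * d).
  { apply (Hstep (L 0%nat) (U 0%nat) d); intros; try apply continuous_const; unfold L, U, d; simpl; lra. }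
  induction n as [|n [CL [CU [HL [HUL [IL IU]]]]]].
  - split; [intros; apply continuous_const|].
    split; [intros; apply continuous_const|].
    split; [intros; unfold L, U, d; simpl; lra|].
    split; [intros; unfold L, U, d; simpl; lra|].
    split; intros x; specialize (HL1 x); specialize (HU1 x); specialize (H01 x);
      change (L 0%nat x) with (Lam lo c ^ 2); change (U 0%nat x) with (Lam hi c ^ 2);
      unfold d; lra.
  - assert (CL' : forall x, continuous (L (S n)) x) by (intros; now apply step_continuous).
    assert (CU' : forall x, continuous (U (S n)) x) by (intros; now apply step_continuous).
    assert (HL' : forall x, Lam lo c ^ 2 <= L (S n) x).
    { intros x. specialize (HL x). specialize (IL x). lra. }
    assert (HUL' : forall x, 0 <= U (S n) x - L (S n) x <= q ^ S n * d).
    { intros x. replace (q ^ S n * d) with (q * (q ^ n * d)) by (simpl; ring).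
      now apply (Hstep (L n) (U n)). }
    split; [exact CL'|]. split; [exact CU'|]. split; [exact HL'|]. split; [exact HUL'|].
    split; intros x.
    + destruct (Hstep (L n) (L (S n)) d CL CL' HL IL x) as [A B].
      split; [exact A|]. eapply Rle_trans; [exact B|]. now apply Hqd.
    + assert (HU' : forall x, Lam lo c ^ 2 <= U (S n) x).
      { intros z. specialize (HL' z). specialize (HUL' z). lra. }
      destruct (Hstep (U (S n)) (U n) d CU' CU HU' IU x) as [A B].
      split; [exact A|]. eapply Rle_trans; [exact B|]. now apply Hqd.
Qed.

(** The limit [r] of the lower iterates is squeezed between [L n] and [U n], whose distance tends to
    0 uniformly, so it inherits continuity. A [sig] type is used so that the branch can later be
    chosen as a function of the speed. *)
Lemma step_fixed_point (k : nat) (c lo hi : R) (g : R -> R) :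
  0 < lo -> (forall x, continuous g x) -> (forall x, lo <= g x <= hi) ->
  0 <= INR k * Lam lo c + c ->
  {r : R -> R | (forall x, continuous r x) /\
    (forall x, Lam lo c ^ 2 <= r x <= Lam hi c ^ 2) /\
    (forall x, step k c g r x = r x)}.
Proof.
  intros Hlo Hg Hb Hk.
  set (L := fun n => Nat.iter n (step k c g) (fun _ => Lam lo c ^ 2)).
  set (U := fun n => Nat.iter n (step k c g) (fun _ => Lam hi c ^ 2)).
  set (d := Lam hi c ^ 2 - Lam lo c ^ 2).
  set (q := (INR k + 1) / (INR k + 2)).
  assert (Inv : forall n,
    (forall x, continuous (L n) x) /\ (forall x, continuous (U n) x) /\
    (forall x, Lam lo c ^ 2 <= L n x) /\ (forall x, 0 <= U n x - L n x <= q ^ n * d) /\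
    (forall x, 0 <= L (S n) x - L n x <= d) /\ (forall x, 0 <= U n x - U (S n) x <= d))
    by (intros n; exact (iterates_spec k c lo hi g n Hlo Hg Hb Hk)).
  assert (HUd : forall n x, U n x <= Lam hi c ^ 2).
  { intros n x. induction n as [|n IH]; [simpl; lra|].
    destruct (Inv n) as [_ [_ [_ [_ [_ IU]]]]]. specialize (IU x). lra. }
  assert (Hlim : forall x, is_lim_seq (fun n => L n x) (real (Lim_seq (fun n => L n x)))).
  { intros x. apply Lim_seq_correct', (ex_finite_lim_seq_incr _ (Lam hi c ^ 2)).
    - intros n. destruct (Inv n) as [_ [_ [_ [_ [IL _]]]]]. specialize (IL x). lra.
    - intros n. destruct (Inv n) as [_ [_ [_ [HUL _]]]]. specialize (HUL x).
      specialize (HUd n x). lra. }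
  exists (fun x => real (Lim_seq (fun n => L n x))).
  set (r := fun x => real (Lim_seq (fun n => L n x))) in *.
  assert (HLr : forall n x, L n x <= r x).
  { intros n x. apply (is_lim_seq_incr_compare (fun n => L n x)); [apply Hlim|].
    intros m. destruct (Inv m) as [_ [_ [_ [_ [IL _]]]]]. specialize (IL x). lra. }
  assert (HrU : forall n x, r x <= U n x).
  { intros n x.
    apply (is_lim_seq_le_loc (fun m => L m x) (fun _ => U n x) (r x) (U n x));
      [|apply Hlim|apply is_lim_seq_const].
    exists n. intros m Hm.
    assert (U m x <= U n x).
    { induction Hm as [|m Hm IH]; [lra|].
      destruct (Inv m) as [_ [_ [_ [_ [_ IU]]]]]. specialize (IU x). lra. }
    destruct (Inv m) as [_ [_ [_ [HUL _]]]]. specialize (HUL x). lra. }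
  pose proof (pos_INR k) as Hkk.
  assert (Hsmall : forall eps, 0 < eps -> exists n, q ^ n * d < eps).
  { intros eps He.
    assert (Hq : Rabs q < 1).
    { unfold q. rewrite Rabs_pos_eq.
      - apply Rmult_lt_reg_r with (INR k + 2); [lra|]. field_simplify; lra.
      - apply Rmult_le_pos; [lra|]. left. apply Rinv_0_lt_compat. lra. }
    pose proof (is_lim_seq_mult' _ _ _ _ (is_lim_seq_geom q Hq) (is_lim_seq_const d)) as Hl.
    rewrite Rmult_0_l in Hl. apply is_lim_seq_spec in Hl.
    destruct (Hl (mkposreal eps He)) as [n Hn]. exists n.
    specialize (Hn n (le_n n)). simpl in Hn. rewrite Rminus_0_r in Hn.
    apply Rabs_def2 in Hn. lra. }
  assert (Cr : forall x, continuous r x).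
  { intros x. apply continuous_eps. intros eps He.
    destruct (Hsmall (eps / 2)) as [n Hn]; [lra|].
    destruct (Inv n) as [CL [_ [_ [HUL _]]]].
    destruct (proj1 (continuous_eps _ _) (CL x) (eps / 2)) as [e [He' H]]; [lra|].
    exists e; split; [exact He'|]. intros y Hy. specialize (H y Hy).
    apply Rabs_def2 in H.
    pose proof (HLr n x). pose proof (HLr n y). pose proof (HrU n x). pose proof (HrU n y).
    pose proof (HUL x). pose proof (HUL y). apply Rabs_def1; lra. }
  split; [exact Cr|]. split.
  - intros x. split; [apply (HLr 0%nat)|apply (HrU 0%nat)].
  - intros x. destruct (Lam_spec lo c Hlo) as [Pl [Pc _]].
    change (step k c g r x = r x).
    (* By monotonicity [step k c g r] lies between [L (S n)] and [U (S n)], and so does [r]. Hence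
       no limit has to be taken under the integral. *)
    apply Rle_antisym; apply le_epsilon; intros eps He;
      destruct (Hsmall eps He) as [n Hn];
      destruct (Inv n) as [CL [CU [HL [HUL _]]]];
      destruct (Inv (S n)) as [_ [_ [_ [HUL' _]]]];
      specialize (HUL' x);
      (assert (q ^ S n * d <= q ^ n * d) as Hdec;
       [ specialize (HUL x); assert (0 <= q <= 1) by
          (unfold q; split;
            [apply Rmult_le_pos; [lra|]; left; apply Rinv_0_lt_compat; lra
            |apply Rmult_le_reg_r with (INR k + 2); [lra|]; field_simplify; lra]);
         simpl; rewrite Rmult_assoc; nra | ]).
    + assert (step k c g r x <= U (S n) x).
      { destruct (step_mono k c (Lam lo c) (q ^ n * d) g r (U n) x) as [A _];
          auto; try lra.
        - intros z. specialize (HL z). specialize (HLr n z). lra.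
        - intros z. specialize (HLr n z). specialize (HrU n z). specialize (HUL z). lra.
        - change (U (S n) x) with (step k c g (U n) x). lra. }
      specialize (HLr (S n) x). lra.
    + assert (L (S n) x <= step k c g r x).
      { destruct (step_mono k c (Lam lo c) (q ^ n * d) g (L n) r x) as [A _];
          auto; try lra.
        - intros z. specialize (HLr n z). specialize (HrU n z). specialize (HUL z). lra.
        - change (L (S n) x) with (step k c g (L n) x). lra. }
      specialize (HrU (S n) x). lra.
Qed.

(* The phase curve is [p y = y * h y]; it satisfies [p p' = c p + g y * y]. *)
Definition is_branch (g : R -> R) (c : R) (h : R -> R) : Prop :=
  (forall x, continuous h x) /\ (forall x, 0 < h x) /\
  (forall y, 0 < y -> is_derive (fun y => y * h y) y (c + g y / h y)).

Lemma branch_exists (c lo hi : R) (g : R -> R) :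
  0 < lo -> (forall x, continuous g x) -> (forall x, lo <= g x <= hi) ->
  {h : R -> R | is_branch g c h /\ forall x, Lam lo c <= h x <= Lam hi c}.
Proof.
  intros Hlo Hg Hb.
  destruct (Lam_spec lo c Hlo) as [Pl _].
  (* Any [k] with [INR k >= Rabs c / Lam lo c] outweighs a negative [c]. *)
  assert (Hk : {k : nat | 0 <= INR k * Lam lo c + c}).
  { destruct (nfloor_ex (Rabs c / Lam lo c)) as [n Hn].
    - apply Rmult_le_pos; [apply Rabs_pos|left; now apply Rinv_0_lt_compat].
    - exists (S n). rewrite S_INR.
      assert (Rabs c / Lam lo c * Lam lo c <= (INR n + 1) * Lam lo c)
        by (apply Rmult_le_compat_r; lra).
      replace (Rabs c / Lam lo c * Lam lo c) with (Rabs c) in H by (field; lra).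
      pose proof (Rle_abs (- c)) as A. rewrite Rabs_Ropp in A. lra. }
  destruct Hk as [k Hk].
  destruct (step_fixed_point k c lo hi g Hlo Hg Hb Hk) as [r [Cr [Br Er]]].
  assert (Hlh : lo <= hi) by (specialize (Hb 0); lra).
  destruct (Lam_spec hi c ltac:(lra)) as [Ph _].
  assert (Pr : forall x, 0 < r x) by (intros x; specialize (Br x); nra).
  exists (fun x => sqrt (r x)). split; [split; [|split]|].
  - intros x. apply (continuous_comp r sqrt); [apply Cr|apply continuous_sqrt].
  - intros x. now apply sqrt_lt_R0.
  - intros y Hy.
    set (F := fun s => s ^ S k * (source k c (r s) + g s)).
    set (I := (fun y => RInt F 0 y) : R -> R).
    assert (CF : forall x, continuous F x).
    { intros x. apply (continuous_ext (fun s => s ^ S k * (source k c (r (1 * s)) + g (1 * s)))).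
      - intros t. unfold F. now rewrite Rmult_1_l.
      - apply (average_integrand_continuous k (fun s => source k c (r s) + g s) 1).
        intros; now apply source_continuous. }
    assert (EI : forall z, 0 < z -> r z = 2 * I z / z ^ (k + 2)).
    { intros z Hz. unfold I, F.
      rewrite <- (average_scaled k (fun s => source k c (r s) + g s))
        by (intros; now apply source_continuous).
      rewrite <- (Er z) at 1. unfold step. field. apply pow_nonzero. lra. }
    assert (DI : is_derive I y (F y)) by now apply is_derive_RInt_cont.
    (* The terms with [k] cancel: this is [p p' = c p + g y * y] with [p ^ 2 = y ^ 2 * r], so the
       branch does not depend on the auxiliary exponent. *)
    assert (Dr : is_derive r y (2 * (c * sqrt (r y) + g y - r y) / y)).
    { apply (is_derive_ext_loc (fun z => 2 * I z / z ^ (k + 2))).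
      - exists (mkposreal y Hy). intros z Hz. symmetry. apply EI.
        change (Rabs (z - y) < y) in Hz. apply Rabs_def2 in Hz. lra.
      - assert (Py : y ^ k <> 0) by (apply pow_nonzero; lra).
        auto_derive.
        + split; [now exists (F y)|]. split; [|easy]. apply pow_nonzero. lra.
        + replace (Derive (fun x : R => I x) y) with (F y) by (symmetry; exact (is_derive_unique _ _ _ DI)).
          assert (EIy : I y = r y * y ^ (k + 2) / 2).
          { rewrite (EI y Hy) at 1. field. apply pow_nonzero; lra. }
          rewrite EIy. unfold F, source.
          replace (pred (k + 2)) with (S k) by lia.
          rewrite plus_INR. replace (k + 2)%nat with (S (S k)) by lia.
          simpl. field. split; [lra|exact Py]. }
    specialize (Pr y).
    pose proof (sqrt_sqrt (r y) ltac:(lra)) as Es.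
    pose proof (sqrt_lt_R0 (r y) Pr) as Ps.
    auto_derive.
    + split; [now eexists; exact Dr|]. now split.
    + replace (Derive (fun x : R => r x) y) with (2 * (c * sqrt (r y) + g y - r y) / y)
        by (symmetry; exact (is_derive_unique _ _ _ Dr)). set (s := sqrt (r y)) in *.
      rewrite <- Es. field. lra.
  - intros x. specialize (Br x).
    rewrite <- (sqrt_pow2 (Lam lo c)), <- (sqrt_pow2 (Lam hi c)) by lra.
    split; apply sqrt_le_1_alt; lra.
Qed.

(** * Comparison and energy of branches *)

Lemma branch_curve_continuous (h : R -> R) (x : R) :
  (forall x, continuous h x) -> continuous (fun y => y * h y) x.
Proof.
  intros H. apply (continuous_mult (K := R_AbsRing) (fun y => y) h); [|apply H].
  apply continuous_id.
Qed.

(** Since [p' = c + g y * y / p], the derivative of the difference is [c2 - c1] minus a positive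
    multiple of [h2 - h1]. It is nonnegative where the difference is negative, which gives the lower
    bound, and then never exceeds [c2 - c1], which gives the upper one. With [c1 = c2] this is
    uniqueness; the upper bound makes the mismatch Lipschitz in the speed. *)
Lemma branch_compare (g h1 h2 : R -> R) (c1 c2 y : R) :
  (forall x, 0 < g x) -> c1 <= c2 -> is_branch g c1 h1 -> is_branch g c2 h2 -> 0 <= y ->
  y * h1 y <= y * h2 y <= y * h1 y + (c2 - c1) * y.
Proof.
  intros Hg Hc [C1 [P1 D1]] [C2 [P2 D2]] Hy.
  set (D := fun y => y * h2 y - y * h1 y).
  set (dD := fun y => (c2 + g y / h2 y) - (c1 + g y / h1 y)).
  assert (CD : forall x, continuous D x).
  { intros x. apply (continuous_minus (V := R_NormedModule)); now apply branch_curve_continuous. }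
  assert (DD : forall y, 0 < y -> is_derive D y (dD y)).
  { intros z Hz. apply (is_derive_minus (V := R_NormedModule) (fun y => y * h2 y) (fun y => y * h1 y));
      [now apply D2|now apply D1]. }
  assert (EdD : forall y, dD y = c2 - c1 - g y / (h1 y * h2 y) * (h2 y - h1 y)).
  { intros z. unfold dD. specialize (P1 z). specialize (P2 z). field. lra. }
  assert (Pk : forall y, 0 < g y / (h1 y * h2 y)).
  { intros z. apply Rdiv_lt_0_compat; [apply Hg|]. now apply Rmult_lt_0_compat. }
  assert (HD : forall y, 0 <= y -> 0 <= D y).
  { intros z Hz. apply (nonneg_of_derive_where_neg D dD z CD); [unfold D; lra|exact DD| |exact Hz].
    intros t Ht Hn. rewrite EdD. specialize (Pk t). unfold D in Hn.
    assert (h2 t < h1 t) by nra. nra. }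
  split; [specialize (HD y Hy); unfold D in HD; lra|].
  assert (E : 0 <= (c2 - c1) * y - D y); [|unfold D in E; lra].
  apply (nonneg_of_derive_where_neg (fun y => (c2 - c1) * y - D y)
           (fun y => (c2 - c1) - dD y) y); [| |  | |exact Hy].
  - intros x. apply (continuous_minus (V := R_NormedModule)); [|apply CD].
    apply (is_derive_continuous _ _ (c2 - c1)). auto_derive; [easy|ring].
  - unfold D. lra.
  - intros t Ht. apply (is_derive_minus (V := R_NormedModule) (fun y => (c2 - c1) * y) D);
      [auto_derive; [easy|ring]|now apply DD].
  - intros t Ht _. rewrite EdD. specialize (Pk t). specialize (HD t ltac:(lra)). unfold D in HD.
    assert (h1 t <= h2 t) by nra. nra.
Qed.

Lemma branch_compare_strict (g h1 h2 : R -> R) (c1 c2 y : R) :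
  (forall x, 0 < g x) -> c1 < c2 -> is_branch g c1 h1 -> is_branch g c2 h2 -> 0 < y ->
  y * h1 y < y * h2 y.
Proof.
  intros Hg Hc B1 B2 Hy.
  destruct (branch_compare g h1 h2 c1 c2 y Hg (Rlt_le _ _ Hc) B1 B2 (Rlt_le _ _ Hy))
    as [[?|E] _]; [assumption|exfalso].
  (* The difference would have a zero minimum at [y] with slope [c2 - c1 > 0]. *)
  pose proof B1 as [_ [_ D1]]. pose proof B2 as [_ [_ D2]].
  assert (Eh : h1 y = h2 y) by nra.
  assert (DD : is_derive (fun y => y * h2 y - y * h1 y) y (c2 - c1)).
  { replace (c2 - c1) with ((c2 + g y / h2 y) - (c1 + g y / h1 y)) by (rewrite Eh; ring).
    apply (is_derive_minus (V := R_NormedModule) (fun y => y * h2 y) (fun y => y * h1 y));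
      [now apply D2|now apply D1]. }
  destruct (derive_pos_local _ _ _ DD ltac:(lra)) as [d [Hd H]].
  set (e := Rmin (d / 2) (y / 2)).
  assert (He : 0 < e) by (apply Rmin_glb_lt; lra).
  pose proof (Rmin_l (d / 2) (y / 2)). pose proof (Rmin_r (d / 2) (y / 2)). fold e in H0, H1.
  assert (H' := H (y - e) ltac:(apply Rabs_def1; lra) ltac:(lra)). cbv beta in H'.
  destruct (branch_compare g h1 h2 c1 c2 (y - e) Hg (Rlt_le _ _ Hc) B1 B2 ltac:(lra)) as [H2 _].
  rewrite E in H'. nra.
Qed.

Lemma weighted_continuous (g : R -> R) (x : R) :
  (forall x, continuous g x) -> continuous (fun s => g s * s) x.
Proof.
  intros Hg. apply (continuous_mult (K := R_AbsRing) g (fun s => s)); [apply Hg|apply continuous_id].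
Qed.

(** The derivative of [p ^ 2 / 2] is [c * p + g y * y]. Only the sign of the term with [c] will
    matter, so the mean value theorem provides [e] in place of the integral of [p]. *)
Lemma branch_energy (g h : R -> R) (c y : R) :
  (forall x, continuous g x) -> is_branch g c h -> 0 < y ->
  exists e, 0 < e /\ (y * h y) ^ 2 / 2 = RInt (fun s => g s * s) 0 y + c * e.
Proof.
  intros Hg [Ch [Ph Dh]] Hy.
  set (F := (fun y => RInt (fun s => g s * s) 0 y) : R -> R).
  assert (DF : forall z, is_derive F z (g z * z)).
  { intros z. apply (is_derive_RInt_cont (fun s => g s * s)).
    intros; now apply weighted_continuous. }
  destruct (mean_value (fun y => (y * h y) ^ 2 / 2 - F y) (fun y => c * (y * h y)) 0 y Hy)
    as [z [Hz E]].
  - intros x Hx.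
    apply (is_derive_ext (fun y => (fun p => p ^ 2 / 2) ((fun y => y * h y) y) - F y)); [easy|].
    replace (c * (x * h x)) with ((c + g x / h x) * (x * h x) - g x * x)
      by (field; specialize (Ph x); lra).
    apply (is_derive_minus (V := R_NormedModule)
             (fun y => (fun p => p ^ 2 / 2) ((fun y => y * h y) y)) F); [|apply DF].
    apply (is_derive_comp (V := R_NormedModule) (fun p => p ^ 2 / 2) (fun y => y * h y)).
    + auto_derive; [easy|field].
    + now apply Dh.
  - intros x _. apply (continuous_minus (V := R_NormedModule)
                         (fun y => (y * h y) ^ 2 / 2) F).
    + apply (continuous_comp (fun y => y * h y) (fun p => p ^ 2 / 2)).
      * now apply branch_curve_continuous.
      * apply (is_derive_continuous _ _ (x * h x)). auto_derive; [easy|field].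
    + eapply is_derive_continuous, DF.
  - exists (z * h z * y). split.
    + repeat apply Rmult_lt_0_compat; [lra|apply Ph|lra].
    + assert (F0 : F 0 = 0) by apply (RInt_point (V := R_CompleteNormedModule)).
      rewrite F0 in E. fold (F y). cbv beta in E. lra.
Qed.

(** * The slopes of the reaction term *)

Lemma C1_on_eps (lo hi : R) (f df : R -> R) (x : R) :
  C1_on lo hi f df -> lo <= x <= hi ->
  forall eps, 0 < eps -> exists delta, 0 < delta /\
    forall y, lo <= y <= hi -> Rabs (y - x) < delta ->
    Rabs (f y - f x - (y - x) * df x) <= eps * Rabs (y - x).
Proof.
  intros [H _] Hx eps He. destruct (H x Hx) as [_ Hd].
  assert (Hl : is_filter_lim (within (fun y => lo <= y <= hi) (locally x)) x).
  { intros P HP. unfold within. now apply filter_imp with (2 := HP). }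
  destruct (Hd x Hl (mkposreal eps He)) as [d Hd']. exists d; split; [apply cond_pos|].
  intros y Hy Hxy. exact (Hd' y Hxy Hy).
Qed.

Lemma C1_on_continuous (lo hi : R) (f df : R -> R) (x : R) :
  C1_on lo hi f df -> lo <= x <= hi ->
  forall eps, 0 < eps -> exists delta, 0 < delta /\
    forall y, lo <= y <= hi -> Rabs (y - x) < delta -> Rabs (f y - f x) < eps.
Proof.
  intros H Hx eps He.
  destruct (C1_on_eps lo hi f df x H Hx 1 Rlt_0_1) as [d [Hd H']].
  pose proof (Rabs_pos (df x)).
  set (k := 1 + Rabs (df x)).
  exists (Rmin d (eps / k)).
  assert (0 < eps / k) by (apply Rdiv_lt_0_compat; unfold k; lra).
  split; [now apply Rmin_glb_lt|].
  intros y Hy Hxy.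
  pose proof (Rmin_l d (eps / k)). pose proof (Rmin_r d (eps / k)).
  specialize (H' y Hy ltac:(lra)).
  replace (f y - f x) with ((f y - f x - (y - x) * df x) + (y - x) * df x) by ring.
  eapply Rle_lt_trans; [apply Rabs_triang|]. rewrite Rabs_mult.
  assert (Rabs (y - x) * k < eps).
  { replace eps with (eps / k * k) by (field; unfold k; lra).
    apply Rmult_lt_compat_r; [unfold k; lra|lra]. }
  unfold k in *. lra.
Qed.

(** Extends data on [[lo, hi]] continuously to the whole line, where [branch_exists] asks for its
    continuity and bounds. *)
Definition clamp (lo hi x : R) : R := Rmax (Rmin x hi) lo.

Lemma clamp_in (lo hi x : R) : lo <= hi -> lo <= clamp lo hi x <= hi.
Proof.
  intros H. unfold clamp. split; [apply Rmax_r|]. apply Rmax_lub; [apply Rmin_r|exact H].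
Qed.

Lemma clamp_id (lo hi x : R) : lo <= x <= hi -> clamp lo hi x = x.
Proof. intros H. unfold clamp. now rewrite Rmin_left, Rmax_left by lra. Qed.

Lemma clamp_lipschitz (lo hi x y : R) : Rabs (clamp lo hi y - clamp lo hi x) <= Rabs (y - x).
Proof.
  unfold clamp, Rmax, Rmin.
  repeat (destruct Rle_dec); unfold Rabs; repeat destruct Rcase_abs; lra.
Qed.

(** The quotient, completed by [df p] at [p] and continued by constants outside [[lo, hi]], is
    continuous, and the set [quotients] is exactly its range. By compactness the supremum is
    attained, so it is negative like every single value. *)
Lemma slope_exists (lo hi p : R) (f df : R -> R) :
  lo < hi -> lo <= p <= hi -> C1_on lo hi f df -> f p = 0 -> df p < 0 ->
  (forall u, lo <= u <= hi -> u <> p -> f u / (u - p) < 0) ->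
  exists psi, (forall x, continuous psi x) /\
    (forall u, lo <= u <= hi -> f u = psi u * (u - p)) /\
    (forall u, real (Glb_Rbar (quotients lo hi f p)) <= psi u
               <= real (Lub_Rbar (quotients lo hi f p))) /\
    real (Lub_Rbar (quotients lo hi f p)) < 0.
Proof.
  intros Hlh Hp Hf Hfp Hdf Hneg.
  set (cl := clamp lo hi).
  assert (Hcl : forall x, lo <= cl x <= hi) by (intros; apply clamp_in; lra).
  set (psi := fun x => if Req_dec_T (cl x) p then df p else f (cl x) / (cl x - p)).
  assert (Hnear : forall eps, 0 < eps -> exists delta, 0 < delta /\
    forall y, lo <= y <= hi -> Rabs (y - p) < delta -> y <> p ->
    Rabs (f y / (y - p) - df p) < eps).
  { intros eps He.
    destruct (C1_on_eps lo hi f df p Hf Hp (eps / 2)) as [d [Hd H]]; [lra|].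
    exists d; split; [exact Hd|]. intros y Hy Hyp n. specialize (H y Hy Hyp).
    rewrite Hfp, Rminus_0_r in H.
    assert (Pa : 0 < Rabs (y - p)) by (apply Rabs_pos_lt; lra).
    apply Rmult_lt_reg_r with (Rabs (y - p)); [exact Pa|].
    rewrite <- Rabs_mult.
    replace ((f y / (y - p) - df p) * (y - p)) with (f y - (y - p) * df p) by (field; lra).
    nra. }
  assert (Cpsi : forall x, continuous psi x).
  { intros x. apply continuous_eps. intros eps He.
    destruct (Req_dec_T (cl x) p) as [e|n].
    - destruct (Hnear eps He) as [d [Hd H]]. exists d; split; [exact Hd|].
      intros y Hy. unfold psi. destruct (Req_dec_T (cl x) p) as [_|]; [|easy].
      destruct (Req_dec_T (cl y) p) as [_|n].
      + replace (df p - df p) with 0 by ring. now rewrite Rabs_R0.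
      + apply H; [apply Hcl| |exact n]. rewrite <- e.
        eapply Rle_lt_trans; [apply clamp_lipschitz|exact Hy].
    - assert (Cc : continuous cl x).
      { apply continuous_eps. intros e0 He0. exists e0; split; [exact He0|]. intros y Hy.
        eapply Rle_lt_trans; [apply clamp_lipschitz|exact Hy]. }
      assert (Cf : continuous (fun x => f (cl x)) x).
      { apply continuous_eps. intros e0 He0.
        destruct (C1_on_continuous lo hi f df (cl x) Hf (Hcl x) e0 He0) as [d [Hd H]].
        exists d; split; [exact Hd|]. intros y Hy. apply H; [apply Hcl|].
        eapply Rle_lt_trans; [apply clamp_lipschitz|exact Hy]. }
      assert (Cq : continuous (fun x => f (cl x) * / (cl x - p)) x).
      { apply (continuous_mult (K := R_AbsRing) (fun x => f (cl x)) (fun x => / (cl x - p)));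
          [exact Cf|].
        apply (continuous_comp (fun x => cl x - p) Rinv).
        - apply (continuous_minus (V := R_NormedModule)); [exact Cc|apply continuous_const].
        - apply continuous_Rinv. lra. }
      destruct (proj1 (continuous_eps _ _) Cq eps He) as [d [Hd H]].
      exists (Rmin d (Rabs (cl x - p))). split.
      { apply Rmin_glb_lt; [exact Hd|]. apply Rabs_pos_lt. lra. }
      intros y Hy.
      assert (Hy1 : Rabs (y - x) < d) by (eapply Rlt_le_trans; [exact Hy|apply Rmin_l]).
      assert (Hy2 : Rabs (y - x) < Rabs (cl x - p))
        by (eapply Rlt_le_trans; [exact Hy|apply Rmin_r]).
      unfold psi. destruct (Req_dec_T (cl x) p) as [|_]; [easy|].
      destruct (Req_dec_T (cl y) p) as [e|_]; [exfalso|now apply H].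
      pose proof (clamp_lipschitz lo hi x y) as L. fold cl in L.
      rewrite e, Rabs_minus_sym in L. lra. }
  assert (Ppsi : forall u, lo <= u <= hi -> f u = psi u * (u - p)).
  { intros u Hu. unfold psi, cl. rewrite clamp_id by exact Hu.
    destruct (Req_dec_T u p) as [->|n]; [rewrite Hfp; ring|field; lra]. }
  assert (Hin : forall u, quotients lo hi f p (psi u)).
  { intros u. unfold psi. destruct (Req_dec_T (cl u) p) as [e|n].
    - right. apply filterlim_locally. intros eps.
      destruct (Hnear eps (cond_pos eps)) as [d [Hd H]].
      exists (mkposreal d Hd). intros y Hy n Hin. now apply H.
    - left. exists (cl u). split; [apply Hcl|]. now split. }
  assert (Hout : forall q, quotients lo hi f p q -> exists u, lo <= u <= hi /\ q = psi u).
  { intros q [[u [Hu [n ->]]]|Hq].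
    - exists u; split; [exact Hu|]. unfold psi, cl. rewrite clamp_id by exact Hu.
      now destruct (Req_dec_T u p).
    - exists p; split; [exact Hp|]. unfold psi, cl. rewrite clamp_id by exact Hp.
      destruct (Req_dec_T p p) as [_|]; [|easy].
      destruct (Req_dec q (df p)) as [|n]; [assumption|exfalso].
      set (eps := Rabs (q - df p) / 2).
      assert (He : 0 < eps) by (unfold eps; pose proof (Rabs_pos_lt (q - df p)); lra).
      destruct (Hnear eps He) as [d [Hd H]].
      apply filterlim_locally with (eps := mkposreal eps He) in Hq.
      destruct Hq as [d' Hq].
      (* Uniqueness of the limit at [p] needs points of [[lo, hi]] close to [p]. As [p] may be an
         end point, either side may be the available one; [e <= (hi - lo) / 2] ensures that one of
         them is. *)
      assert (Hu : exists u, lo <= u <= hi /\ u <> p /\ Rabs (u - p) < d /\ Rabs (u - p) < d').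
      { pose proof (cond_pos d') as Hd'.
        set (e := Rmin (Rmin (d / 2) (d' / 2)) ((hi - lo) / 2)).
        pose proof (Rmin_l (Rmin (d / 2) (d' / 2)) ((hi - lo) / 2)).
        pose proof (Rmin_r (Rmin (d / 2) (d' / 2)) ((hi - lo) / 2)).
        pose proof (Rmin_l (d / 2) (d' / 2)). pose proof (Rmin_r (d / 2) (d' / 2)).
        assert (0 < e) by (repeat apply Rmin_glb_lt; lra). fold e in H0, H1.
        destruct (Rle_dec (p + e) hi).
        - exists (p + e). replace (p + e - p) with e by ring.
          rewrite Rabs_pos_eq by lra. repeat split; lra.
        - exists (p - e). replace (p - e - p) with (- e) by ring.
          rewrite Rabs_Ropp, Rabs_pos_eq by lra. repeat split; lra. }
      destruct Hu as [u [Hu [Hn [H1 H2]]]].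
      specialize (H u Hu H1 Hn). specialize (Hq u H2 Hn Hu).
      change (Rabs (f u / (u - p) - q) < eps) in Hq.
      set (s := f u / (u - p)) in *.
      assert (Rabs (q - df p) < 2 * eps); [|unfold eps in *; lra].
      apply Rabs_def2 in H. apply Rabs_def2 in Hq. apply Rabs_def1; lra. }
  destruct (continuity_ab_maj psi lo hi) as [M [HM HM']]; [lra| |].
  { intros c _. apply continuity_pt_filterlim, Cpsi. }
  destruct (continuity_ab_min psi lo hi) as [m [Hm Hm']]; [lra| |].
  { intros c _. apply continuity_pt_filterlim, Cpsi. }
  assert (Hclp : forall u, psi u = psi (cl u)).
  { intros u. unfold psi. replace (cl (cl u)) with (cl u); [easy|].
    apply eq_sym, clamp_id, Hcl. }
  (* An attained bound is finite, so [real] returns it and not its default value. *)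
  assert (EL : Lub_Rbar (quotients lo hi f p) = Finite (psi M)).
  { apply is_lub_Rbar_unique. split.
    - intros q Hq. destruct (Hout q Hq) as [u [Hu ->]]. now apply HM.
    - intros b Hb. apply Hb, Hin. }
  assert (EG : Glb_Rbar (quotients lo hi f p) = Finite (psi m)).
  { apply is_glb_Rbar_unique. split.
    - intros q Hq. destruct (Hout q Hq) as [u [Hu ->]]. now apply Hm.
    - intros b Hb. apply Hb, Hin. }
  exists psi. rewrite EL, EG. simpl.
  split; [exact Cpsi|]. split; [exact Ppsi|]. split.
  - intros u. rewrite (Hclp u). split; [now apply Hm|now apply HM].
  - unfold psi. destruct (Req_dec_T (cl M) p); [exact Hdf|]. now apply Hneg.
Qed.

(** * Autonomous scalar equations *)

Lemma inv_continuous (W : R -> R) (x : R) :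
  (forall x, continuous W x) -> (forall x, 0 < W x) -> continuous (fun x => / W x) x.
Proof.
  intros HW HP. apply (continuous_comp W Rinv); [apply HW|].
  apply continuous_Rinv. specialize (HP x). lra.
Qed.

(** Separation of variables: [X] is the inverse of the travel time [H]. The bound [W <= M] makes [H]
    onto and its inverse continuous; [m <= W] gives the linear growth from which the limits of the
    wave follow. *)
Lemma autonomous_exists (W : R -> R) (m M x0 : R) :
  (forall x, continuous W x) -> 0 < m -> (forall x, m <= W x <= M) ->
  exists X : R -> R, X 0 = x0 /\ (forall z, is_derive X z (W (X z))) /\
    (forall z, 0 <= z -> x0 + m * z <= X z) /\ (forall z, z <= 0 -> X z <= x0 + m * z).
Proof.
  intros HW Hm Hb.
  assert (HP : forall x, 0 < W x) by (intros x; specialize (Hb x); lra).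
  assert (HM : 0 < M) by (specialize (Hb 0); lra).
  set (H := (fun x => RInt (fun x => / W x) x0 x) : R -> R).
  assert (DH : forall x, is_derive H x (/ W x)).
  { intros x. apply (is_derive_RInt_cont (fun x => / W x)). intros; now apply inv_continuous. }
  assert (CH : forall x, continuous H x) by (intros; eapply is_derive_continuous, DH).
  assert (H0 : H x0 = 0) by apply (RInt_point (V := R_CompleteNormedModule)).
  assert (Hlow : forall x y, x <= y -> (y - x) / M <= H y - H x).
  { intros x y Hxy.
    assert (H x - x / M <= H y - y / M); [|unfold Rdiv in *; lra].
    apply (nondecreasing_of_derive (fun x => H x - x / M) (fun x => / W x - / M));
      [exact Hxy| | |].
    - intros t _. apply (is_derive_minus (V := R_NormedModule) H (fun x => x / M)); [apply DH|].
      auto_derive; [easy|field; lra].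
    - intros t _. apply (continuous_minus (V := R_NormedModule) H (fun x => x / M)); [apply CH|].
      apply (is_derive_continuous _ _ (/ M)). auto_derive; [easy|field; lra].
    - intros t _. assert (/ M <= / W t); [|lra]. apply Rinv_le_contravar; [apply HP|apply Hb]. }
  assert (HX : forall z, {x | H x = z}).
  { intros z. pose proof (Rabs_pos z) as Pz.
    destruct (IVT_gen H (x0 - M * Rabs z) (x0 + M * Rabs z) z) as [x [_ E]].
    - now apply continuous_continuity.
    - assert (E1 : H (x0 - M * Rabs z) <= - Rabs z).
      { assert (Q : x0 - M * Rabs z <= x0) by nra. specialize (Hlow _ _ Q).
        replace ((x0 - (x0 - M * Rabs z)) / M) with (Rabs z) in Hlow by (field; lra). lra. }
      assert (E2 : Rabs z <= H (x0 + M * Rabs z)).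
      { assert (Q : x0 <= x0 + M * Rabs z) by nra. specialize (Hlow _ _ Q).
        replace ((x0 + M * Rabs z - x0) / M) with (Rabs z) in Hlow by (field; lra). lra. }
      pose proof (Rmin_l (H (x0 - M * Rabs z)) (H (x0 + M * Rabs z))).
      pose proof (Rmax_r (H (x0 - M * Rabs z)) (H (x0 + M * Rabs z))).
      pose proof (Rle_abs z). pose proof (Rle_abs (- z)). rewrite Rabs_Ropp in *. lra.
    - now exists x. }
  set (X := fun z => proj1_sig (HX z)).
  assert (EX : forall z, H (X z) = z) by (intros z; exact (proj2_sig (HX z))).
  assert (CX : forall z, continuous X z).
  { intros z. apply continuous_eps. intros eps He.
    exists (eps / M). split; [now apply Rdiv_lt_0_compat|].
    intros y Hy. rewrite <- (EX y), <- (EX z) in Hy.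
    apply Rmult_lt_reg_r with (/ M); [now apply Rinv_0_lt_compat|].
    eapply Rle_lt_trans; [|exact Hy].
    destruct (Rle_dec (X z) (X y)) as [L|L].
    - specialize (Hlow _ _ L). rewrite (Rabs_pos_eq (X y - X z)) by lra.
      eapply Rle_trans; [exact Hlow|apply Rle_abs].
    - assert (L' : X y <= X z) by lra. specialize (Hlow _ _ L').
      rewrite (Rabs_minus_sym (X y)), (Rabs_minus_sym (H (X y))).
      rewrite (Rabs_pos_eq (X z - X y)) by lra.
      eapply Rle_trans; [exact Hlow|apply Rle_abs]. }
  assert (DX : forall z, is_derive X z (W (X z))).
  { intros z. rewrite <- (Rinv_inv (W (X z))).
    apply (is_derive_inverse H X z); [apply DH| |exact EX|apply CX].
    apply Rinv_neq_0_compat. specialize (HP (X z)). lra. }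
  assert (X0 : X 0 = x0).
  { destruct (Rle_dec (X 0) x0) as [L|L].
    - specialize (Hlow _ _ L). rewrite H0, EX in Hlow.
      apply Rle_antisym; [exact L|]. apply Rmult_le_reg_r with (/ M); [now apply Rinv_0_lt_compat|].
      unfold Rdiv in Hlow. lra.
    - assert (L' : x0 <= X 0) by lra. specialize (Hlow _ _ L'). rewrite H0, EX in Hlow.
      apply Rle_antisym; [|exact L']. apply Rmult_le_reg_r with (/ M); [now apply Rinv_0_lt_compat|].
      unfold Rdiv in Hlow. lra. }
  assert (Hmono : forall y z, y <= z -> X y - m * y <= X z - m * z).
  { intros y z Hyz.
    apply (nondecreasing_of_derive (fun z => X z - m * z) (fun z => W (X z) - m)); [exact Hyz| | |].
    - intros t _. apply (is_derive_minus (V := R_NormedModule) X (fun z => m * z)); [apply DX|].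
      auto_derive; [easy|ring].
    - intros t _. apply (continuous_minus (V := R_NormedModule) X (fun z => m * z)); [apply CX|].
      apply (is_derive_continuous _ _ m). auto_derive; [easy|ring].
    - intros t _. specialize (Hb (X t)). lra. }
  exists X. split; [exact X0|]. split; [exact DX|].
  split; intros z Hz; specialize (Hmono _ _ Hz); lra.
Qed.

(** [W] is merely continuous, so positivity takes the place of a Lipschitz condition: along every
    solution the travel time [H] advances at unit rate, and [H] is injective. *)
Lemma autonomous_unique (W X1 X2 : R -> R) (z : R) :
  (forall x, continuous W x) -> (forall x, 0 < W x) ->
  (forall z, is_derive X1 z (W (X1 z))) -> (forall z, is_derive X2 z (W (X2 z))) ->
  X1 0 = X2 0 -> X1 z = X2 z.
Proof.
  intros HW HP D1 D2 E0.
  set (H := (fun x => RInt (fun x => / W x) 0 x) : R -> R).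
  assert (DH : forall x, is_derive H x (/ W x)).
  { intros x. apply (is_derive_RInt_cont (fun x => / W x)). intros; now apply inv_continuous. }
  assert (HX : forall X, (forall z, is_derive X z (W (X z))) -> forall z, H (X z) = H (X 0) + z).
  { intros X DX y.
    assert (DHX : forall t, is_derive (fun t => H (X t) - t) t 0).
    { intros t. replace 0 with (W (X t) * / W (X t) - 1) by (field; specialize (HP (X t)); lra).
      apply (is_derive_minus (V := R_NormedModule) (fun t => H (X t)) (fun t => t)).
      - apply (is_derive_comp (V := R_NormedModule) H X); [apply DH|apply DX].
      - auto_derive; easy. }
    destruct (Rtotal_order y 0) as [L|[->|L]]; [|lra|].
    - destruct (mean_value _ _ y 0 L (fun t _ => DHX t)) as [c [_ E]]; [|lra].
      intros; eapply is_derive_continuous, DHX.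
    - destruct (mean_value _ _ 0 y L (fun t _ => DHX t)) as [c [_ E]]; [|lra].
      intros; eapply is_derive_continuous, DHX. }
  assert (Hinc : forall x y, x < y -> H x < H y).
  { intros x y Hxy. apply (increasing_of_derive H (fun x => / W x)); [exact Hxy| | |]; intros.
    - apply DH.
    - eapply is_derive_continuous, DH.
    - now apply Rinv_0_lt_compat. }
  pose proof (HX X1 D1 z) as E1. pose proof (HX X2 D2 z) as E2. rewrite E0, <- E2 in E1.
  destruct (Rtotal_order (X1 z) (X2 z)) as [L|[L|L]]; [|exact L|]; apply Hinc in L; lra.
Qed.

(** * Orbits converging to the saddle as [z] tends to [-oo] *)

Lemma is_lim_m_infty_eps (u : R -> R) (l eps : R) :
  is_lim u m_infty l -> 0 < eps -> exists M, forall x, x < M -> Rabs (u x - l) < eps.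
Proof.
  intros H He. apply is_lim_spec in H. exact (H (mkposreal eps He)).
Qed.

(** The deviation [D = v - u * h u] satisfies [D' = - (g / h) * D], so [D ^ 2] can only grow
    backwards in [z]; yet there are points arbitrarily far to the left where [u] and [v], hence [D],
    are small. The equation for [v] is asked only before [z0], where the wave meets the jump of the
    reaction term. *)
Lemma orbit_on_branch (g h u v : R -> R) (c G H z0 : R) :
  (forall x, 0 < g x <= G) -> is_branch g c h -> (forall x, h x <= H) ->
  (forall z, is_derive u z (v z)) -> (forall z, continuous v z) ->
  (forall z, z < z0 -> is_derive v z (c * v z + g (u z) * u z)) ->
  (forall z, z <= z0 -> 0 <= u z) -> is_lim u m_infty 0 -> 0 < u z0 ->
  forall z, z <= z0 -> 0 < u z /\ v z = u z * h (u z).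
Proof.
  intros Hg [Ch [Ph Dh]] HH Du Cv Dv Hu Hlim Hu0.
  assert (Cu : forall z, continuous u z) by (intros; eapply is_derive_continuous, Du).
  (* [v z * exp (- c * z)] is nondecreasing, so a negative value of [v] persists to the left. Then
     [u] decreases in [z] all along and stays away from 0 at minus infinity. *)
  assert (Pv : forall z, z <= z0 -> 0 <= v z).
  { intros z2 Hz2. destruct (Rle_dec 0 (v z2)) as [|n]; [assumption|exfalso].
    assert (Hneg : forall z, z <= z2 -> v z < 0).
    { intros z Hz.
      assert (Q : v z * exp (- c * z) <= v z2 * exp (- c * z2)).
      { apply (nondecreasing_of_derive (fun z => v z * exp (- c * z))
                 (fun z => g (u z) * u z * exp (- c * z))); [exact Hz| | |].
        - intros t Ht. assert (Dt := Dv t ltac:(lra)). auto_derive.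
          + eexists; exact Dt.
          + replace (Derive (fun x : R => v x) t) with (c * v t + g (u t) * u t)
              by (symmetry; exact (is_derive_unique _ _ _ Dt)). ring.
        - intros t _. apply (continuous_mult (K := R_AbsRing) v (fun z => exp (- c * z)));
            [apply Cv|]. eapply is_derive_continuous. auto_derive; [easy|reflexivity].
        - intros t Ht. repeat apply Rmult_le_pos.
          + apply Rlt_le, Hg.
          + apply Hu; lra.
          + apply Rlt_le, exp_pos. }
      pose proof (exp_pos (- c * z)). pose proof (exp_pos (- c * z2)). nra. }
    assert (Hdec : forall x y, x < y -> y <= z2 -> u y < u x).
    { intros x y Hxy Hy. destruct (mean_value u v x y Hxy) as [t [Ht E]];
        [intros; apply Du|intros; apply Cu|].
      specialize (Hneg t ltac:(lra)). nra. }
    pose proof (Hdec (z2 - 1) z2 ltac:(lra) ltac:(lra)) as Q1.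
    pose proof (Hu z2 Hz2) as Q2.
    destruct (is_lim_m_infty_eps u 0 (u (z2 - 1)) Hlim ltac:(lra)) as [M HM].
    pose proof (Rmin_l M (z2 - 1)). pose proof (Rmin_r M (z2 - 1)).
    set (t := Rmin M (z2 - 1) - 1) in *.
    specialize (HM t ltac:(unfold t; lra)).
    specialize (Hdec t (z2 - 1) ltac:(unfold t; lra) ltac:(lra)).
    apply Rabs_def2 in HM. lra. }
  assert (Pu : forall z, z <= z0 -> 0 < u z).
  { intros z1 Hz1. destruct (Hu z1 Hz1) as [|E]; [assumption|exfalso].
    assert (Hlt : z1 < z0) by (destruct Hz1 as [|e]; [assumption|rewrite e in E; lra]).
    assert (Ev : v z1 = 0).
    { destruct (Pv z1 Hz1) as [L|]; [exfalso|congruence].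
      destruct (derive_pos_local u z1 (v z1) (Du z1) L) as [d [Hd Q]].
      assert (Q' := Q (z1 - d / 2) ltac:(apply Rabs_def1; lra) ltac:(lra)). rewrite <- E in Q'.
      specialize (Hu (z1 - d / 2) ltac:(lra)). nra. }
    (* Gronwall for [u + v], which vanishes at [z1] but not at [z0]. *)
    set (K := 1 + Rabs c + G).
    assert (Q : - ((u z1 + v z1) * exp (- K * z1)) <= - ((u z0 + v z0) * exp (- K * z0))).
    { apply (nondecreasing_of_derive (fun z => - ((u z + v z) * exp (- K * z)))
        (fun z => (K * (u z + v z) - (v z + (c * v z + g (u z) * u z))) * exp (- K * z)));
        [lra| | |].
      - intros t Ht. assert (Dt := Dv t ltac:(lra)). auto_derive.
        + split; [eexists; apply Du|]. split; [|easy]. eexists; exact Dt.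
        + replace (Derive (fun x : R => v x) t) with (c * v t + g (u t) * u t)
            by (symmetry; exact (is_derive_unique _ _ _ Dt)).
          replace (Derive (fun x : R => u x) t) with (v t)
            by (symmetry; exact (is_derive_unique _ _ _ (Du t))). ring.
      - intros t _.
        apply (continuous_opp (V := R_NormedModule) (fun z => (u z + v z) * exp (- K * z))).
        apply (continuous_mult (K := R_AbsRing) (fun z => u z + v z) (fun z => exp (- K * z))).
        + apply (continuous_plus (V := R_NormedModule)); [apply Cu|apply Cv].
        + eapply is_derive_continuous. auto_derive; [easy|reflexivity].
      - intros t Ht. apply Rmult_le_pos; [|apply Rlt_le, exp_pos].
        specialize (Pv t ltac:(lra)). specialize (Hu t ltac:(lra)).
        destruct (Hg (u t)) as [g1 g2]. pose proof (Rle_abs c). pose proof (Rabs_pos c).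
        assert (g (u t) * u t <= G * u t) by (apply Rmult_le_compat_r; lra).
        assert (c * v t <= Rabs c * v t) by (apply Rmult_le_compat_r; lra).
        assert (0 <= G * v t) by (apply Rmult_le_pos; lra).
        assert (0 <= Rabs c * u t) by (apply Rmult_le_pos; lra).
        unfold K. nra. }
    rewrite <- E, Ev in Q. specialize (Pv z0 ltac:(lra)). pose proof (exp_pos (- K * z0)). nra. }
  intros z1 Hz1. split; [now apply Pu|].
  set (D := fun z => v z - u z * h (u z)).
  assert (CD : forall z, continuous D z).
  { intros z. apply (continuous_minus (V := R_NormedModule) v (fun z => u z * h (u z))); [apply Cv|].
    apply (continuous_comp u (fun y => y * h y)); [apply Cu|now apply branch_curve_continuous]. }
  assert (DD : forall z, z < z0 -> is_derive D z (- (g (u z) / h (u z)) * D z)).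
  { intros z Hz.
    replace (- (g (u z) / h (u z)) * D z)
      with ((c * v z + g (u z) * u z) - v z * (c + g (u z) / h (u z)))
      by (unfold D; field; specialize (Ph (u z)); lra).
    apply (is_derive_minus (V := R_NormedModule) v (fun z => u z * h (u z))); [now apply Dv|].
    apply (is_derive_comp (V := R_NormedModule) (fun y => y * h y) u); [|apply Du].
    apply Dh, Pu. lra. }
  assert (Hmono : forall z, z <= z1 -> - D z ^ 2 <= - D z1 ^ 2).
  { intros z Hz.
    apply (nondecreasing_of_derive (fun z => - D z ^ 2)
             (fun z => 2 * (g (u z) / h (u z)) * D z ^ 2)); [exact Hz| | |].
    - intros t Ht. assert (Dt := DD t ltac:(lra)). auto_derive; [eexists; exact Dt|].
      replace (Derive (fun x : R => D x) t) with (- (g (u t) / h (u t)) * D t)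
        by (symmetry; exact (is_derive_unique _ _ _ Dt)). ring.
    - intros t _. apply (continuous_comp D (fun x => - x ^ 2)); [apply CD|].
      eapply is_derive_continuous. auto_derive; [easy|reflexivity].
    - intros t _. apply Rmult_le_pos; [|apply pow2_ge_0].
      apply Rmult_le_pos; [lra|]. apply Rlt_le, Rdiv_lt_0_compat; [apply Hg|apply Ph]. }
  destruct (Req_dec (D z1) 0) as [e|n]; [unfold D in e; lra|exfalso].
  assert (PH : 0 < H) by (specialize (HH 0); specialize (Ph 0); lra).
  (* Chosen so that [v s < eps] and [u s < eps] force [Rabs (D s) < eps * (1 + H) = Rabs (D z1)]. *)
  set (eps := Rabs (D z1) / (1 + H)).
  pose proof (Rabs_pos_lt _ n) as Pd.
  assert (He : 0 < eps) by (apply Rdiv_lt_0_compat; lra).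
  destruct (is_lim_m_infty_eps u 0 eps Hlim He) as [M HM].
  pose proof (Rmin_l M z1). pose proof (Rmin_r M z1).
  set (t := Rmin M z1 - 1) in *.
  (* No limit of [v] is known; the mean value theorem on an interval of length 1 finds a point [s]
     with [v s = u t - u (t - 1)], which is small. *)
  destruct (mean_value u v (t - 1) t) as [s [Hs E]];
    [lra|intros; apply Du|intros; apply Cu|].
  assert (A1 := HM t ltac:(unfold t; lra)). assert (A2 := HM s ltac:(unfold t in *; lra)).
  apply Rabs_def2 in A1. apply Rabs_def2 in A2.
  assert (Hs1 : s <= z1) by (unfold t in *; lra).
  specialize (Hmono s Hs1). specialize (Pv s ltac:(lra)).
  assert (Pus := Pu s ltac:(lra)). assert (Put := Pu (t - 1) ltac:(unfold t in *; lra)).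
  assert (Hvs : v s < eps) by lra.
  assert (Huh : 0 <= u s * h (u s) <= eps * H).
  { specialize (Ph (u s)). specialize (HH (u s)). split; [nra|].
    apply Rmult_le_compat; lra. }
  assert (Hlt : Rabs (D s) < Rabs (D z1)).
  { replace (Rabs (D z1)) with (eps * (1 + H)) by (unfold eps; field; lra).
    unfold D at 1. apply Rabs_def1; nra. }
  apply Rsqr_lt_abs_1 in Hlt. unfold Rsqr in Hlt. nra.
Qed.

(** * The two bounding speeds *)

(** The speed equation says that the line through 0 of slope [Lam (- alpha) c] and the line through
    1 of slope [- Lam (- beta) (- c)] meet above [u = a]. *)
Lemma speed_eq_Lam (a alpha beta c : R) :
  0 < a < 1 -> alpha < 0 -> beta < 0 ->
  speed_eq a alpha beta c <-> a * Lam (- alpha) c = (1 - a) * Lam (- beta) (- c).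
Proof.
  intros Ha Hal Hbe. unfold speed_eq.
  replace (lambda_plus alpha c) with (Lam (- alpha) c)
    by (unfold Lam, lambda_plus; do 3 f_equal; ring).
  replace (lambda_minus beta c) with (- Lam (- beta) (- c)).
  2:{ unfold Lam, lambda_minus.
      replace ((- c) ^ 2 + 4 * - beta) with (c ^ 2 - 4 * beta) by ring. field. }
  destruct (Lam_spec (- alpha) c ltac:(lra)) as [P1 _].
  destruct (Lam_spec (- beta) (- c) ltac:(lra)) as [P2 _].
  set (p := Lam (- alpha) c) in *. set (q := Lam (- beta) (- c)) in *.
  split; intros E.
  - assert (a * (- q - p) = - q) by (rewrite E at 1; field; lra). lra.
  - apply Rmult_eq_reg_r with (- q - p); [|lra].
    replace (- q / (- q - p) * (- q - p)) with (- q) by (field; lra). lra.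
Qed.

(* With [x = a * Lam g0 c = (1 - a) * Lam g1 (- c)], eliminating [c] from the two
   characteristic equations leaves [x ^ 2 = a (1 - a) (a g0 + (1 - a) g1)]. *)
Lemma balanced_speed_unique (a g0 g1 : R) :
  0 < a < 1 -> 0 < g0 -> 0 < g1 ->
  exists c, unique (fun c => a * Lam g0 c = (1 - a) * Lam g1 (- c)) c.
Proof.
  intros Ha H0 H1.
  set (s := a * (1 - a) * (a * g0 + (1 - a) * g1)).
  assert (Hs : 0 < s) by (unfold s; repeat apply Rmult_lt_0_compat; nra).
  pose proof (sqrt_lt_R0 s Hs) as Px. pose proof (sqrt_sqrt s ltac:(lra)) as Ex.
  set (x := sqrt s) in *.
  (* The characteristic equation of [p = x / a] solved for the speed: [c = p - g0 / p]. *)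
  exists (x / a - a * g0 / x). split.
  - assert (E0 : x / a = Lam g0 (x / a - a * g0 / x)).
    { apply Lam_unique; [lra|apply Rdiv_lt_0_compat; lra|]. field. lra. }
    assert (E1 : x / (1 - a) = Lam g1 (- (x / a - a * g0 / x))).
    { apply Lam_unique; [lra|apply Rdiv_lt_0_compat; lra|].
      apply Rminus_diag_uniq.
      replace ((x / (1 - a)) ^ 2 - (- (x / a - a * g0 / x) * (x / (1 - a)) + g1))
        with ((x * x - s) / (a * (1 - a) ^ 2)) by (unfold s; field; lra).
      rewrite Ex. field. lra. }
    rewrite <- E0, <- E1. field. lra.
  - intros c E.
    destruct (Lam_spec g0 c H0) as [P0 [_ Q0]]. destruct (Lam_spec g1 (- c) H1) as [P1 [_ Q1]].
    set (p := Lam g0 c) in *. set (q := Lam g1 (- c)) in *.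
    assert (Ep : (a * p) * (a * p) = x * x).
    { rewrite Ex. unfold s.
      replace (a * g0 + (1 - a) * g1)
        with ((a * p) * p + ((1 - a) * q) * q - c * (a * p) + c * ((1 - a) * q)) by nra.
      rewrite <- E.
      replace (a * (1 - a) * (a * p * p + a * p * q - c * (a * p) + c * (a * p)))
        with ((a * p) * ((1 - a) * (a * p) + a * ((1 - a) * q))) by ring.
      rewrite <- E. ring. }
    assert (Exp : x = a * p).
    { apply Rsqr_inj; [lra|nra|]. unfold Rsqr. lra. }
    rewrite Exp. assert (c = p - g0 / p); [|rewrite H; field; lra].
    apply Rmult_eq_reg_r with p; [|lra]. field_simplify; lra.
Qed.

(** * The travelling wave *)

(** The inverse of the logit. This coordinate moves the end states 0 and 1 to infinity, so that the
    equation for the profile loses its zeros. *)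
Definition logistic (x : R) : R := / (1 + exp (- x)).

Lemma logistic_in (x : R) : 0 < logistic x < 1.
Proof.
  unfold logistic. pose proof (exp_pos (- x)). split.
  - apply Rinv_0_lt_compat; lra.
  - rewrite <- Rinv_1 at 2. apply Rinv_lt_contravar; lra.
Qed.

Lemma logistic_derive (x : R) : is_derive logistic x (logistic x * (1 - logistic x)).
Proof.
  unfold logistic. pose proof (exp_pos (- x)). auto_derive; [lra|field; lra].
Qed.

Lemma logistic_logit (s : R) : 0 < s < 1 -> logistic (ln (s / (1 - s))) = s.
Proof.
  intros Hs. unfold logistic.
  rewrite <- ln_Rinv by (apply Rdiv_lt_0_compat; lra).
  rewrite exp_ln by (apply Rinv_0_lt_compat, Rdiv_lt_0_compat; lra).
  field. lra.
Qed.

Lemma logistic_ge (x : R) : 1 - exp (- x) <= logistic x.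
Proof.
  unfold logistic. pose proof (exp_pos (- x)).
  apply Rmult_le_reg_r with (1 + exp (- x)); [lra|]. rewrite Rinv_l by lra. nra.
Qed.

Lemma logistic_le (x : R) : logistic x <= exp x.
Proof.
  unfold logistic. pose proof (exp_pos (- x)).
  replace (exp x) with (/ exp (- x)) by (rewrite exp_Ropp, Rinv_inv; easy).
  apply Rinv_le_contravar; lra.
Qed.

(* The growth rate [p u / (u (1 - u))] of the logit of the wave, where the phase curve
   [p] is [u * h0 u] below [a] and [(1 - u) * h1 (1 - u)] above. A product with clamped
   arguments keeps it continuous; one factor is the constant [h0 a / (1 - a)] on each side. *)
Definition logit_rate (a : R) (h0 h1 : R -> R) (s : R) : R :=
  (h0 (Rmin s a) / (1 - Rmin s a)) * (h1 (1 - Rmax s a) / Rmax s a) / (h0 a / (1 - a)).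

Lemma logit_rate_continuous (a : R) (h0 h1 : R -> R) (s : R) :
  0 < a < 1 -> (forall x, continuous h0 x) -> (forall x, continuous h1 x) ->
  continuous (logit_rate a h0 h1) s.
Proof.
  intros Ha C0 C1.
  pose proof (Rmin_r s a). pose proof (Rmax_r s a).
  apply (continuous_mult (K := R_AbsRing)
    (fun s => (h0 (Rmin s a) / (1 - Rmin s a)) * (h1 (1 - Rmax s a) / Rmax s a))
    (fun _ => / (h0 a / (1 - a)))); [|apply continuous_const].
  apply (continuous_mult (K := R_AbsRing)
    (fun s => (h0 (Rmin s a) / (1 - Rmin s a))) (fun s => (h1 (1 - Rmax s a) / Rmax s a))).
  - apply (continuous_comp (fun s => Rmin s a) (fun t => h0 t / (1 - t)));
      [apply Rmin_continuous|].
    apply (continuous_mult (K := R_AbsRing) h0 (fun t => / (1 - t))); [apply C0|].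
    eapply is_derive_continuous. auto_derive; [lra|reflexivity].
  - apply (continuous_comp (fun s => Rmax s a) (fun t => h1 (1 - t) / t));
      [apply Rmax_continuous|].
    apply (continuous_mult (K := R_AbsRing) (fun t => h1 (1 - t)) (fun t => / t)).
    + apply (continuous_comp (fun t => 1 - t) h1); [|apply C1].
      eapply is_derive_continuous. auto_derive; [easy|reflexivity].
    + apply continuous_Rinv. lra.
Qed.

Lemma logit_rate_pos (a : R) (h0 h1 : R -> R) (s : R) :
  0 < a < 1 -> (forall x, 0 < h0 x) -> (forall x, 0 < h1 x) -> 0 < logit_rate a h0 h1 s.
Proof.
  intros Ha P0 P1. unfold logit_rate.
  pose proof (Rmin_r s a). pose proof (Rmax_r s a).
  apply Rdiv_lt_0_compat; [apply Rmult_lt_0_compat|]; apply Rdiv_lt_0_compat;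
    try apply P0; try apply P1; lra.
Qed.

Lemma logit_rate_low (a : R) (h0 h1 : R -> R) (s : R) :
  0 < a < 1 -> (forall x, 0 < h0 x) -> a * h0 a = (1 - a) * h1 (1 - a) -> s <= a ->
  s * (1 - s) * logit_rate a h0 h1 s = s * h0 s.
Proof.
  intros Ha P0 E Hs. unfold logit_rate. rewrite Rmin_left, Rmax_right by lra.
  replace (h1 (1 - a)) with (a * h0 a / (1 - a)) by (rewrite E; field; lra).
  specialize (P0 a). field. lra.
Qed.

Lemma logit_rate_high (a : R) (h0 h1 : R -> R) (s : R) :
  0 < a < 1 -> (forall x, 0 < h0 x) -> a <= s ->
  s * (1 - s) * logit_rate a h0 h1 s = (1 - s) * h1 (1 - s).
Proof.
  intros Ha P0 Hs. unfold logit_rate. rewrite Rmin_right, Rmax_left by lra.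
  specialize (P0 a). field. lra.
Qed.

(** The wave solves [u' = P u], where [P] is the phase curve glued from both branches. Matching
    makes [P] continuous at [a], so [u] is C1 in spite of the jump of the reaction term; away from
    [a], differentiating [u' = P u] gives the equation. *)
Lemma wave_exists (a c : R) (f0 f1 g0 g1 h0 h1 : R -> R) :
  0 < a < 1 ->
  (forall u, 0 <= u <= a -> f0 u = - (g0 u * u)) ->
  (forall u, a <= u <= 1 -> f1 u = g1 (1 - u) * (1 - u)) ->
  is_branch g0 c h0 -> is_branch g1 (- c) h1 ->
  a * h0 a = (1 - a) * h1 (1 - a) ->
  exists u, travelling_wave a (glue a f0 f1) c u.
Proof.
  intros Ha F0 F1 [C0 [P0 D0]] [C1 [P1 D1]] E.
  set (rate := logit_rate a h0 h1).
  set (W := fun x => rate (logistic x)).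
  assert (Crate : forall s, continuous rate s) by (intros; now apply logit_rate_continuous).
  assert (Prate : forall s, 0 < rate s) by (intros; now apply logit_rate_pos).
  assert (CW : forall x, continuous W x).
  { intros x. apply (continuous_comp logistic rate); [|apply Crate].
    eapply is_derive_continuous, logistic_derive. }
  destruct (continuity_ab_maj rate 0 1) as [sM [HM _]]; [lra| |].
  { intros s _. apply continuity_pt_filterlim, Crate. }
  destruct (continuity_ab_min rate 0 1) as [sm [Hm _]]; [lra| |].
  { intros s _. apply continuity_pt_filterlim, Crate. }
  destruct (autonomous_exists W (rate sm) (rate sM) (ln (a / (1 - a))) CW (Prate sm))
    as [X [X0 [DX [Xp Xn]]]].
  { intros x. pose proof (logistic_in x). split; [apply Hm|apply HM]; lra. }
  set (P := fun s => s * (1 - s) * rate s).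
  set (u := fun z => logistic (X z)).
  assert (Hu : forall z, 0 < u z < 1) by (intros; apply logistic_in).
  assert (CP : forall s, continuous P s).
  { intros s. apply (continuous_mult (K := R_AbsRing) (fun s => s * (1 - s)) rate);
      [|apply Crate]. eapply is_derive_continuous. auto_derive; [easy|reflexivity]. }
  assert (Du : forall z, is_derive u z (P (u z))).
  { intros z. replace (P (u z)) with (W (X z) * (logistic (X z) * (1 - logistic (X z))))
      by (unfold P, W, u; ring).
    apply (is_derive_comp (V := R_NormedModule) logistic X); [apply logistic_derive|apply DX]. }
  assert (Cu : forall z, continuous u z) by (intros; eapply is_derive_continuous, Du).
  assert (Dv : forall z, u z <> a ->
    is_derive (fun z => P (u z)) z (c * P (u z) - glue a f0 f1 (u z))).
  { intros z n. specialize (Hu z).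
    destruct (Rlt_dec (u z) a) as [L|L].
    - replace (c * P (u z) - glue a f0 f1 (u z))
        with (P (u z) * (c + g0 (u z) / h0 (u z))).
      2:{ unfold glue. destruct (Rle_dec (u z) a); [|lra]. rewrite F0 by lra.
          unfold P, rate. rewrite logit_rate_low by (auto; lra).
          specialize (P0 (u z)). field. lra. }
      apply (is_derive_comp (V := R_NormedModule) P u); [|apply Du].
      apply (is_derive_ext_loc (fun s => s * h0 s)); [|apply D0; lra].
      exists (mkposreal (a - u z) ltac:(lra)). intros s Hs.
      change (Rabs (s - u z) < a - u z) in Hs. apply Rabs_def2 in Hs.
      symmetry. apply logit_rate_low; auto; lra.
    - replace (c * P (u z) - glue a f0 f1 (u z))
        with (P (u z) * (-1 * (- c + g1 (1 - u z) / h1 (1 - u z)))).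
      2:{ unfold glue. destruct (Rle_dec (u z) a); [lra|]. rewrite F1 by lra.
          unfold P, rate. rewrite logit_rate_high by (auto; lra).
          specialize (P1 (1 - u z)). field. lra. }
      apply (is_derive_comp (V := R_NormedModule) P u); [|apply Du].
      apply (is_derive_ext_loc (fun s => (fun y => y * h1 y) (1 - s))).
      + exists (mkposreal (u z - a) ltac:(lra)). intros s Hs.
        change (Rabs (s - u z) < u z - a) in Hs. apply Rabs_def2 in Hs.
        symmetry. apply logit_rate_high; auto; lra.
      + apply (is_derive_comp (V := R_NormedModule) (fun y => y * h1 y) (fun s => 1 - s)).
        * apply D1; lra.
        * auto_derive; [easy|ring]. }
  assert (Eu1 : forall z, Derive u z = P (u z)) by (intros; apply is_derive_unique, Du).
  assert (Eu2 : forall z, u z <> a ->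
    ex_derive_n u 2 z /\ Derive_n u 2 z = c * P (u z) - glue a f0 f1 (u z)).
  { intros z n.
    assert (DD : is_derive (Derive u) z (c * P (u z) - glue a f0 f1 (u z))).
    { apply (is_derive_ext (fun z => P (u z))); [intros; now rewrite Eu1|now apply Dv]. }
    split; [eexists; exact DD|]. now apply is_derive_unique. }
  pose proof (Prate sm) as Pm.
  exists u. constructor.
  - intros x t n. destruct (Eu2 (x + c * t) n) as [E1 E2].
    assert (Dt : is_derive (fun s => u (x + c * s)) t (c * P (u (x + c * t)))).
    { apply (is_derive_comp (V := R_NormedModule) u (fun s => x + c * s)); [apply Du|].
      auto_derive; [easy|ring]. }
    split; [eexists; exact Dt|]. split; [now apply ex_derive_n_comp_trans|].
    rewrite (Derive_n_comp_trans u 2 x (c * t)), E2.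
    transitivity (c * P (u (x + c * t))); [now apply is_derive_unique|ring].
  - intros z. specialize (Hu z). lra.
  - intros z. eexists. apply Du.
  - intros z. apply (continuous_ext (fun z => P (u z))); [intros; now rewrite Eu1|].
    apply (continuous_comp u P); [apply Cu|apply CP].
  - intros z n. destruct (Eu2 z n) as [E1 E2]. split; [exact E1|]. rewrite E2, Eu1. ring.
  - unfold u. rewrite X0. now apply logistic_logit.
  - apply is_lim_spec. intros eps.
    (* Solves [ln (a / (1 - a)) + rate sm * z < ln eps] for [z], as [u z <= exp (X z)] and [X] lies
       below this line for negative [z]. *)
    exists (Rmin 0 ((ln eps - ln (a / (1 - a))) / rate sm)). intros z Hz.
    pose proof (Rmin_l 0 ((ln eps - ln (a / (1 - a))) / rate sm)).
    pose proof (Rmin_r 0 ((ln eps - ln (a / (1 - a))) / rate sm)).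
    rewrite Rminus_0_r, Rabs_pos_eq by (specialize (Hu z); lra).
    eapply Rle_lt_trans; [apply logistic_le|].
    rewrite <- (exp_ln eps) by apply cond_pos. apply exp_increasing.
    eapply Rle_lt_trans; [apply Xn; lra|].
    assert (z * rate sm < (ln eps - ln (a / (1 - a))) / rate sm * rate sm)
      by (apply Rmult_lt_compat_r; lra).
    replace ((ln eps - ln (a / (1 - a))) / rate sm * rate sm)
      with (ln eps - ln (a / (1 - a))) in H1 by (field; lra). lra.
  - apply is_lim_spec. intros eps.
    exists (Rmax 0 ((- ln eps - ln (a / (1 - a))) / rate sm)). intros z Hz.
    pose proof (Rmax_l 0 ((- ln eps - ln (a / (1 - a))) / rate sm)).
    pose proof (Rmax_r 0 ((- ln eps - ln (a / (1 - a))) / rate sm)).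
    rewrite Rabs_minus_sym, Rabs_pos_eq by (specialize (Hu z); lra).
    assert (exp (- X z) < eps); [|pose proof (logistic_ge (X z)); unfold u; lra].
    rewrite <- (exp_ln eps) by apply cond_pos. apply exp_increasing.
    specialize (Xp z ltac:(lra)).
    assert ((- ln eps - ln (a / (1 - a))) / rate sm * rate sm < z * rate sm)
      by (apply Rmult_lt_compat_r; lra).
    replace ((- ln eps - ln (a / (1 - a))) / rate sm * rate sm)
      with (- ln eps - ln (a / (1 - a))) in H1 by (field; lra). lra.
Qed.

(** * The shape of an arbitrary wave *)

Lemma wave_derivatives (a c : R) (f u : R -> R) :
  travelling_wave a f c u ->
  (forall z, is_derive u z (Derive u z)) /\
  (forall z, u z <> a -> is_derive (Derive u) z (c * Derive u z - f (u z))).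
Proof.
  intros T. split.
  - intros z. apply Derive_correct, (tw_derivable _ _ _ _ T).
  - intros z n. destruct (tw_ode _ _ _ _ T z n) as [E1 E2].
    replace (c * Derive u z - f (u z)) with (Derive (Derive u) z).
    + exact (Derive_correct _ _ E1).
    + change (Derive_n u 2 z) with (Derive (Derive u) z) in E2. lra.
Qed.

(** The normalisation [u 0 = a] does not by itself say that 0 is the first passage; that is
    concluded only once returns to [a] are excluded. *)
Lemma first_passage (a : R) (u : R -> R) :
  (forall z, continuous u z) -> is_lim u m_infty 0 -> 0 < a -> u 0 = a ->
  exists z0, z0 <= 0 /\ u z0 = a /\ forall z, z < z0 -> u z < a.
Proof.
  intros Cu Hl Ha H0.
  destruct (is_lim_m_infty_eps u 0 a Hl Ha) as [M HM].
  pose proof (Rmin_l M 0). pose proof (Rmin_r M 0).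
  set (x1 := Rmin M 0 - 1) in *.
  assert (Hx : forall x, x <= x1 -> u x < a).
  { intros x Hx. specialize (HM x ltac:(unfold x1 in *; lra)). apply Rabs_def2 in HM. lra. }
  destruct (first_zero (fun z => u z - a) x1 0) as [z0 [Hz [E Hn]]].
  - intros x. apply (continuous_minus (V := R_NormedModule)); [apply Cu|apply continuous_const].
  - unfold x1; lra.
  - specialize (Hx x1 ltac:(lra)). lra.
  - lra.
  - exists z0. split; [lra|]. split; [lra|]. intros z L.
    destruct (Rle_dec z x1); [now apply Hx|]. specialize (Hn z ltac:(lra)). lra.
Qed.

(* Past its first passage at [a] the wave has positive energy [v ^ 2 / 2 + F u], where
   [F] is the primitive of [f] with [F 0 = 0], and the energy increases. Were [u] to come
   back to [a], it would do so with [v < 0], and [v] could not vanish again as [F <= 0]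
   below [a]. *)
Lemma wave_no_return (a c z0 : R) (f0 f1 g0 g1 h0 u : R -> R) :
  0 < a < 1 -> 0 < c ->
  (forall x, continuous g0 x) -> (forall x, continuous g1 x) -> (forall x, 0 < g0 x) ->
  (forall u, 0 <= u <= a -> f0 u = - (g0 u * u)) ->
  (forall u, a <= u <= 1 -> f1 u = g1 (1 - u) * (1 - u)) ->
  is_branch g0 c h0 -> travelling_wave a (glue a f0 f1) c u ->
  u z0 = a -> Derive u z0 = a * h0 a ->
  forall z, z0 < z -> a < u z.
Proof.
  intros Ha Hc Cg0 Cg1 Pg0 F0 F1 B T Eu Ev z1 Hz1.
  destruct (wave_derivatives _ _ _ _ T) as [Du Dv].
  set (v := Derive u) in *.
  pose proof (tw_C1 _ _ _ _ T) as Cv. fold v in Cv.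
  pose proof (tw_range _ _ _ _ T) as Ru.
  assert (Cu : forall z, continuous u z) by (intros; eapply is_derive_continuous, Du).
  assert (Pv0 : 0 < v z0) by (rewrite Ev; apply Rmult_lt_0_compat; [lra|apply B]).
  destruct (Rlt_dec a (u z1)) as [|n]; [assumption|exfalso].
  assert (Hret : exists zs, z0 < zs /\ u zs = a /\ forall z, z0 < z < zs -> a < u z).
  { destruct (derive_pos_local u z0 (v z0) (Du z0) Pv0) as [d [Hd Q]].
    pose proof (Rmin_l (d / 2) ((z1 - z0) / 2)). pose proof (Rmin_r (d / 2) ((z1 - z0) / 2)).
    set (e := Rmin (d / 2) ((z1 - z0) / 2)) in *.
    assert (0 < e) by (apply Rmin_glb_lt; lra).
    assert (Hnear : forall z, z0 < z <= z0 + e -> a < u z).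
    { intros z Hz. assert (Q' := Q z ltac:(apply Rabs_def1; lra) ltac:(lra)). rewrite Eu in Q'. nra. }
    destruct (first_zero (fun z => a - u z) (z0 + e) z1) as [zs [Hs [E Hn]]].
    - intros x. apply (continuous_minus (V := R_NormedModule)); [apply continuous_const|apply Cu].
    - lra.
    - specialize (Hnear (z0 + e) ltac:(lra)). lra.
    - lra.
    - exists zs. split; [lra|]. split; [lra|]. intros z Hz.
      destruct (Rle_dec z (z0 + e)); [apply Hnear; lra|]. specialize (Hn z ltac:(lra)). lra. }
  destruct Hret as [zs [Hzs [Eus Habove]]].
  (* [R1] and [- R0] are primitives of the reaction term above and below [a]; the energy is followed
     on each side separately. *)
  set (R1 := (fun y => RInt (fun s => g1 (1 - s) * (1 - s)) a y) : R -> R).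
  set (R0 := (fun y => RInt (fun s => g0 s * s) 0 y) : R -> R).
  assert (DR1 : forall y, is_derive R1 y (g1 (1 - y) * (1 - y))).
  { intros y. apply (is_derive_RInt_cont (fun s => g1 (1 - s) * (1 - s))). intros x.
    apply (continuous_comp (fun s => 1 - s) (fun s => g1 s * s)); [|now apply weighted_continuous].
    eapply is_derive_continuous. auto_derive; [easy|reflexivity]. }
  assert (DR0 : forall y, is_derive R0 y (g0 y * y)).
  { intros y. apply (is_derive_RInt_cont (fun s => g0 s * s)). intros x.
    now apply weighted_continuous. }
  assert (R0nonneg : forall y, 0 <= y -> 0 <= R0 y).
  { intros y Hy. replace 0 with (R0 0) by apply (RInt_point (V := R_CompleteNormedModule)).
    apply (nondecreasing_of_derive R0 (fun y => g0 y * y)); [exact Hy| | |].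
    - intros; apply DR0.
    - intros; eapply is_derive_continuous, DR0.
    - intros t Ht. specialize (Pg0 t). apply Rmult_le_pos; lra. }
  assert (Cen : forall (G dG : R -> R), (forall y, is_derive G y (dG y)) -> forall z,
    continuous (fun z => v z ^ 2 / 2 + G (u z)) z).
  { intros G dG DG z.
    apply (continuous_plus (V := R_NormedModule) (fun z => v z ^ 2 / 2) (fun z => G (u z))).
    - apply (continuous_comp v (fun x => x ^ 2 / 2)); [apply Cv|].
      eapply is_derive_continuous. auto_derive; [easy|reflexivity].
    - apply (continuous_comp u G); [apply Cu|]. eapply is_derive_continuous, DG. }
  assert (Energy : forall (G dG : R -> R) x y, x <= y -> (forall y, is_derive G y (dG y)) ->
    (forall z, x < z < y -> u z <> a /\ dG (u z) = glue a f0 f1 (u z)) ->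
    v x ^ 2 / 2 + G (u x) <= v y ^ 2 / 2 + G (u y)).
  { intros G dG x y Hxy DG HG.
    apply (nondecreasing_of_derive (fun z => v z ^ 2 / 2 + G (u z)) (fun z => c * v z ^ 2));
      [exact Hxy| | |].
    - intros z Hz. destruct (HG z Hz) as [n' E'].
      replace (c * v z ^ 2) with ((c * v z - glue a f0 f1 (u z)) * v z + v z * dG (u z))
        by (rewrite E'; ring).
      apply (is_derive_plus (V := R_NormedModule) (fun z => v z ^ 2 / 2) (fun z => G (u z))).
      + apply (is_derive_comp (V := R_NormedModule) (fun x => x ^ 2 / 2) v); [|now apply Dv].
        auto_derive; [easy|field].
      + apply (is_derive_comp (V := R_NormedModule) G u); [apply DG|apply Du].
    - intros z _. now apply (Cen G dG).
    - intros z _. apply Rmult_le_pos; [lra|apply pow2_ge_0]. }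
  assert (E1 : v z0 ^ 2 / 2 + R1 (u z0) <= v zs ^ 2 / 2 + R1 (u zs)).
  { apply (Energy R1 (fun y => g1 (1 - y) * (1 - y))); [lra|exact DR1|].
    intros z Hz. specialize (Habove z Hz). specialize (Ru z). split; [lra|].
    unfold glue. destruct (Rle_dec (u z) a); [lra|]. rewrite F1; lra. }
  rewrite Eu, Eus in E1.
  destruct (branch_energy g0 h0 c a Cg0 B ltac:(lra)) as [e [He E0]].
  rewrite <- Ev in E0. change (v z0 ^ 2 / 2 = R0 a + c * e) in E0.
  assert (Hce : 0 < c * e) by now apply Rmult_lt_0_compat.
  pose proof (R0nonneg a ltac:(lra)) as PR0a.
  assert (Hvs : v zs < 0).
  { destruct (Rle_dec (v zs) 0) as [[|Z]|N]; [assumption|rewrite Z in E1; lra|exfalso].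
    destruct (derive_pos_local u zs (v zs) (Du zs) ltac:(lra)) as [d [Hd Q]].
    pose proof (Rmin_l (d / 2) ((zs - z0) / 2)). pose proof (Rmin_r (d / 2) ((zs - z0) / 2)).
    set (e' := Rmin (d / 2) ((zs - z0) / 2)) in *.
    assert (0 < e') by (apply Rmin_glb_lt; lra).
    assert (Q' := Q (zs - e') ltac:(apply Rabs_def1; lra) ltac:(lra)). specialize (Habove (zs - e') ltac:(lra)). nra. }
  assert (Hbelow : forall z, zs < z -> (forall t, zs <= t < z -> v t < 0) -> u z < a).
  { intros z Hz Hn. destruct (mean_value u v zs z Hz) as [t [Ht E]];
      [intros; apply Du|intros; apply Cu|].
    specialize (Hn t ltac:(lra)). nra. }
  assert (Hneg : forall z, zs <= z -> v z < 0).
  { intros z Hz. destruct (Rlt_dec (v z) 0) as [|N]; [assumption|exfalso].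
    destruct (first_zero v zs z Cv Hz Hvs ltac:(lra)) as [z2 [Hz2 [Ez2 Hn]]].
    (* At [zs] this energy is at least [v z0 ^ 2 / 2 - R0 a = c * e > 0], whereas at [z2], where [v]
       vanishes, it is [- R0 (u z2) <= 0]. *)
    assert (E2 : v zs ^ 2 / 2 + - R0 (u zs) <= v z2 ^ 2 / 2 + - R0 (u z2)).
    { apply (Energy (fun y => - R0 y) (fun y => - (g0 y * y))); [lra| |].
      - intros y. apply (is_derive_opp (V := R_NormedModule) R0), DR0.
      - intros t Ht. assert (u t < a).
        { apply Hbelow; [lra|]. intros s Hs. apply Hn. lra. }
        specialize (Ru t). split; [lra|].
        unfold glue. destruct (Rle_dec (u t) a); [|lra]. now rewrite F0. }
    rewrite Ez2, Eus in E2. pose proof (R0nonneg (u z2) (proj1 (Ru z2))). lra. }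
  pose proof (tw_plus_infty _ _ _ _ T) as Hl. apply is_lim_spec in Hl.
  destruct (Hl (mkposreal (1 - a) ltac:(lra))) as [M HM].
  pose proof (Rmax_l M zs). pose proof (Rmax_r M zs).
  specialize (HM (Rmax M zs + 1) ltac:(lra)). simpl in HM. apply Rabs_def2 in HM.
  assert (u (Rmax M zs + 1) < a); [|lra].
  apply Hbelow; [lra|]. intros t Ht. apply Hneg. lra.
Qed.

(** Every wave runs along the two branches, so it is determined by them and increases. The left half
    is an orbit leaving the saddle 0; the right half becomes one after a reflection. *)
Lemma wave_profile (a c K0 K1 G0 G1 : R) (f0 f1 g0 g1 h0 h1 u : R -> R) :
  0 < a < 1 -> 0 < c ->
  (forall x, continuous g0 x) -> (forall x, continuous g1 x) ->
  (forall x, 0 < g0 x <= G0) -> (forall x, 0 < g1 x <= G1) ->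
  (forall u, 0 <= u <= a -> f0 u = - (g0 u * u)) ->
  (forall u, a <= u <= 1 -> f1 u = g1 (1 - u) * (1 - u)) ->
  is_branch g0 c h0 -> is_branch g1 (- c) h1 ->
  (forall x, h0 x <= K0) -> (forall x, h1 x <= K1) ->
  travelling_wave a (glue a f0 f1) c u ->
  (forall z, z <= 0 -> 0 < u z <= a /\ Derive u z = u z * h0 (u z)) /\
  (forall z, 0 <= z -> a <= u z < 1 /\ Derive u z = (1 - u z) * h1 (1 - u z)).
Proof.
  intros Ha Hc Cg0 Cg1 Pg0 Pg1 F0 F1 B0 B1 HK0 HK1 T.
  destruct (wave_derivatives _ _ _ _ T) as [Du Dv].
  pose proof (tw_C1 _ _ _ _ T) as Cv.
  pose proof (tw_range _ _ _ _ T) as Ru.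
  assert (Cu : forall z, continuous u z) by (intros; eapply is_derive_continuous, Du).
  destruct (first_passage a u Cu (tw_minus_infty _ _ _ _ T) ltac:(lra) (tw_origin _ _ _ _ T))
    as [z0 [Hz0 [Eu Hbelow]]].
  assert (Left : forall z, z <= z0 -> 0 < u z /\ Derive u z = u z * h0 (u z)).
  { apply (orbit_on_branch g0 h0 u (Derive u) c G0 K0 z0 Pg0 B0 HK0 Du Cv).
    - intros z Hz. specialize (Hbelow z Hz). specialize (Ru z).
      replace (c * Derive u z + g0 (u z) * u z) with (c * Derive u z - glue a f0 f1 (u z)).
      + apply Dv. lra.
      + unfold glue. destruct (Rle_dec (u z) a); [|lra]. rewrite F0; lra.
    - intros z _. apply Ru.
    - apply (tw_minus_infty _ _ _ _ T).
    - lra. }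
  assert (Ev : Derive u z0 = a * h0 a) by (rewrite <- Eu; apply Left; lra).
  assert (Habove : forall z, z0 < z -> a < u z).
  { apply (wave_no_return a c z0 f0 f1 g0 g1 h0 u); auto. intros; apply Pg0. }
  (* [u 0 = a] would otherwise be a return to [a] after the first passage. *)
  assert (z0 = 0).
  { destruct Hz0 as [L|]; [|assumption]. specialize (Habove 0 L).
    pose proof (tw_origin _ _ _ _ T). lra. }
  subst z0. split.
  - intros z Hz. destruct (Left z Hz) as [L1 L2]. repeat split; [exact L1| |exact L2].
    destruct Hz as [L| ->]; [|lra]. specialize (Hbelow z L). lra.
  - assert (Right : forall z, z <= 0 ->
      0 < 1 - u (- z) /\ Derive u (- z) = (1 - u (- z)) * h1 (1 - u (- z))).
    { apply (orbit_on_branch g1 h1 (fun z => 1 - u (- z)) (fun z => Derive u (- z)) (- c) G1 K1 0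
               Pg1 B1 HK1).
      - intros z.
        replace (Derive u (- z)) with ((-1 * Derive u (- z)) * -1) by ring.
        apply (is_derive_comp (V := R_NormedModule) (fun x => 1 - x) (fun z => u (- z))).
        + auto_derive; [easy|ring].
        + apply (is_derive_comp (V := R_NormedModule) u Ropp); [apply Du|].
          auto_derive; [easy|ring].
      - intros z. apply (continuous_comp Ropp (Derive u)); [|apply Cv].
        eapply is_derive_continuous. auto_derive; [easy|reflexivity].
      - intros z Hz. specialize (Habove (- z) ltac:(lra)). specialize (Ru (- z)).
        replace (- c * Derive u (- z) + g1 (1 - u (- z)) * (1 - u (- z)))
          with (-1 * (c * Derive u (- z) - glue a f0 f1 (u (- z)))).
        + apply (is_derive_comp (V := R_NormedModule) (Derive u) Ropp); [apply Dv; lra|].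
          auto_derive; [easy|ring].
        + unfold glue. destruct (Rle_dec (u (- z)) a); [lra|]. rewrite F1; lra.
      - intros z _. specialize (Ru (- z)). lra.
      - pose proof (tw_plus_infty _ _ _ _ T) as Hl. apply is_lim_spec in Hl.
        apply is_lim_spec. intros eps. destruct (Hl eps) as [M HM].
        exists (- M). intros z Hz. specialize (HM (- z) ltac:(lra)).
        rewrite <- Rabs_Ropp. replace (- (1 - u (- z) - 0)) with (u (- z) - 1) by ring.
        exact HM.
      - rewrite Ropp_0, Eu. lra. }
    intros z Hz. destruct (Right (- z) ltac:(lra)) as [L1 L2].
    rewrite Ropp_involutive in L1, L2. split; [|exact L2]. split; [|lra].
    destruct Hz as [L| <-]; [|lra]. specialize (Habove z L). lra.
Qed.

(** * Uniqueness of the profile *)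

Lemma profile_logit (a : R) (h0 h1 u : R -> R) :
  0 < a < 1 -> (forall x, 0 < h0 x) -> a * h0 a = (1 - a) * h1 (1 - a) ->
  (forall z, is_derive u z (Derive u z)) ->
  (forall z, z <= 0 -> 0 < u z <= a /\ Derive u z = u z * h0 (u z)) ->
  (forall z, 0 <= z -> a <= u z < 1 /\ Derive u z = (1 - u z) * h1 (1 - u z)) ->
  forall z, 0 < u z < 1 /\
    is_derive (fun z => ln (u z / (1 - u z))) z
      (logit_rate a h0 h1 (logistic (ln (u z / (1 - u z))))).
Proof.
  intros Ha P0 E Du HL HR z.
  assert (Q : 0 < u z < 1 /\ Derive u z = u z * (1 - u z) * logit_rate a h0 h1 (u z)).
  { destruct (Rle_dec z 0) as [Hz|Hz].
    - destruct (HL z Hz) as [Q1 Q2]. split; [lra|]. rewrite Q2, logit_rate_low; auto; lra.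
    - destruct (HR z ltac:(lra)) as [Q1 Q2]. split; [lra|]. rewrite Q2, logit_rate_high; auto; lra. }
  destruct Q as [Q1 Q2]. split; [exact Q1|].
  rewrite logistic_logit by exact Q1.
  auto_derive.
  - repeat split; try (eexists; apply Du); [lra|]. apply Rdiv_lt_0_compat; lra.
  - change (Derive (fun x : R => u x) z) with (Derive u z). rewrite Q2. field. lra.
Qed.

(** Both logits solve the same autonomous equation with a positive right-hand side and the same
    value at 0. *)
Lemma wave_unique (a : R) (h0 h1 u1 u2 : R -> R) :
  0 < a < 1 -> (forall x, continuous h0 x) -> (forall x, continuous h1 x) ->
  (forall x, 0 < h0 x) -> (forall x, 0 < h1 x) -> a * h0 a = (1 - a) * h1 (1 - a) ->
  (forall u, u = u1 \/ u = u2 ->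
    (forall z, is_derive u z (Derive u z)) /\ u 0 = a /\
    (forall z, z <= 0 -> 0 < u z <= a /\ Derive u z = u z * h0 (u z)) /\
    (forall z, 0 <= z -> a <= u z < 1 /\ Derive u z = (1 - u z) * h1 (1 - u z))) ->
  forall z, u1 z = u2 z.
Proof.
  intros Ha C0 C1 P0 P1 E H z.
  destruct (H u1 (or_introl eq_refl)) as [D1 [Z1 [L1 R1]]].
  destruct (H u2 (or_intror eq_refl)) as [D2 [Z2 [L2 R2]]].
  pose proof (profile_logit a h0 h1 u1 Ha P0 E D1 L1 R1) as Q1.
  pose proof (profile_logit a h0 h1 u2 Ha P0 E D2 L2 R2) as Q2.
  rewrite <- (logistic_logit (u1 z)), <- (logistic_logit (u2 z)) by (apply Q1 || apply Q2).
  f_equal.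
  apply (autonomous_unique (fun x => logit_rate a h0 h1 (logistic x))
           (fun z => ln (u1 z / (1 - u1 z))) (fun z => ln (u2 z / (1 - u2 z)))).
  - intros x. apply (continuous_comp logistic (logit_rate a h0 h1)).
    + eapply is_derive_continuous, logistic_derive.
    + now apply logit_rate_continuous.
  - intros x. now apply logit_rate_pos.
  - intros x. apply Q1.
  - intros x. apply Q2.
  - now rewrite Z1, Z2.
Qed.

(** * Matching the branches at [u = a] *)

Theorem theorem2p1 (a : R) (f0 df0 f1 df1 : R -> R)
  (ha : 0 < a < 1)
  (hf0 : C1_on 0 a f0 df0) (hf1 : C1_on a 1 f1 df1)
  (hf00 : f0 0 = 0) (hdf00 : df0 0 < 0)
  (hf11 : f1 1 = 0) (hdf11 : df1 1 < 0)
  (hf0neg : forall u, 0 < u <= a -> f0 u < 0)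
  (hf1pos : forall u, a <= u < 1 -> 0 < f1 u)
  (hint : 0 < RInt f0 0 a + RInt f1 a 1) :
  exists c_check c_hat : R,
    is_c_check a f0 f1 c_check /\ is_c_hat a f0 f1 c_hat /\
    exists (cstar : R) (ustar : R -> R),
      0 < cstar /\
      travelling_wave a (glue a f0 f1) cstar ustar /\
      (forall (c : R) (u : R -> R),
         0 < c -> travelling_wave a (glue a f0 f1) c u ->
         c = cstar /\ forall z, u z = ustar z) /\
      c_check <= cstar <= c_hat.
Proof.
  destruct (slope_exists 0 a 0 f0 df0) as [psi0 [Cp0 [Ep0 [Bp0 Np0]]]];
    [lra|lra|exact hf0|exact hf00|exact hdf00| |].
  { intros u Hu n. rewrite Rminus_0_r.
    apply Rmult_lt_reg_r with u; [lra|]. unfold Rdiv.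
    rewrite Rmult_assoc, Rinv_l by lra. specialize (hf0neg u ltac:(lra)). lra. }
  destruct (slope_exists a 1 1 f1 df1) as [psi1 [Cp1 [Ep1 [Bp1 Np1]]]];
    [lra|lra|exact hf1|exact hf11|exact hdf11| |].
  { intros u Hu n. replace (f1 u / (u - 1)) with (- (f1 u / (1 - u))) by (field; lra).
    specialize (hf1pos u ltac:(lra)).
    assert (0 < f1 u / (1 - u)) by (apply Rdiv_lt_0_compat; lra). lra. }
  fold (alpha_inf a f0) (alpha_sup a f0) in Bp0, Np0.
  fold (beta_inf a f1) (beta_sup a f1) in Bp1, Np1.
  (* The sign makes the slopes positive; [1 - y] makes [y] the distance to the end state 1. *)
  set (g0 := fun x => - psi0 x). set (g1 := fun y => - psi1 (1 - y)).
  assert (Cg0 : forall x, continuous g0 x).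
  { intros x. apply (continuous_opp (V := R_NormedModule)), Cp0. }
  assert (Cg1 : forall x, continuous g1 x).
  { intros x. apply (continuous_opp (V := R_NormedModule) (fun y => psi1 (1 - y))).
    apply (continuous_comp (fun y => 1 - y) psi1); [|apply Cp1].
    eapply is_derive_continuous. auto_derive; [easy|reflexivity]. }
  assert (Bg0 : forall x, - alpha_sup a f0 <= g0 x <= - alpha_inf a f0).
  { intros x. specialize (Bp0 x). unfold g0. lra. }
  assert (Bg1 : forall x, - beta_sup a f1 <= g1 x <= - beta_inf a f1).
  { intros x. specialize (Bp1 (1 - x)). unfold g1. lra. }
  assert (Ef0 : forall u, 0 <= u <= a -> f0 u = - (g0 u * u)).
  { intros u Hu. rewrite Ep0 by exact Hu. unfold g0. ring. }
  assert (Ef1 : forall u, a <= u <= 1 -> f1 u = g1 (1 - u) * (1 - u)).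
  { intros u Hu. rewrite Ep1 by exact Hu. unfold g1.
    replace (1 - (1 - u)) with u by ring. ring. }
  assert (Na : alpha_inf a f0 < 0) by (specialize (Bp0 0); lra).
  assert (Nb : beta_inf a f1 < 0) by (specialize (Bp1 0); lra).
  assert (Pg0 : forall x, 0 < g0 x) by (intros x; specialize (Bg0 x); lra).
  assert (Pg1 : forall x, 0 < g1 x) by (intros x; specialize (Bg1 x); lra).
  set (b0 := fun c => branch_exists c _ _ g0 (Ropp_0_gt_lt_contravar _ Np0) Cg0 Bg0).
  set (b1 := fun c => branch_exists c _ _ g1 (Ropp_0_gt_lt_contravar _ Np1) Cg1 Bg1).
  set (h0 := fun c => proj1_sig (b0 c)). set (h1 := fun c => proj1_sig (b1 c)).
  assert (B0 : forall c, is_branch g0 c (h0 c)) by (intros; apply (proj2_sig (b0 c))).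
  assert (B1 : forall c, is_branch g1 c (h1 c)) by (intros; apply (proj2_sig (b1 c))).
  assert (H0 : forall c x, Lam (- alpha_sup a f0) c <= h0 c x <= Lam (- alpha_inf a f0) c)
    by (intros; apply (proj2_sig (b0 c))).
  assert (H1 : forall c x, Lam (- beta_sup a f1) c <= h1 c x <= Lam (- beta_inf a f1) c)
    by (intros; apply (proj2_sig (b1 c))).
  clearbody h0 h1. clear b0 b1.
  destruct (balanced_speed_unique a (- alpha_inf a f0) (- beta_sup a f1)) as [cc [Ecc Ucc]];
    [exact ha|lra|lra|].
  destruct (balanced_speed_unique a (- alpha_sup a f0) (- beta_inf a f1)) as [ch [Ech Uch]];
    [exact ha|lra|lra|].
  exists cc, ch.
  split. { split; [now apply speed_eq_Lam|]. intros c Hc. apply Ucc. now apply speed_eq_Lam in Hc. }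
  split. { split; [now apply speed_eq_Lam|]. intros c Hc. apply Uch. now apply speed_eq_Lam in Hc. }
  set (mismatch := fun c => a * h0 c a - (1 - a) * h1 (- c) (1 - a)).
  (* The branches contribute increments of at most [a * (c2 - c1)] and [(1 - a) * (c2 - c1)], which
     add up to [c2 - c1]. *)
  assert (Mlip : forall c1 c2, c1 <= c2 ->
    mismatch c1 <= mismatch c2 <= mismatch c1 + (c2 - c1)).
  { intros c1 c2 Hc.
    pose proof (branch_compare g0 (h0 c1) (h0 c2) c1 c2 a Pg0 Hc (B0 c1) (B0 c2) ltac:(lra)).
    pose proof (branch_compare g1 (h1 (- c2)) (h1 (- c1)) (- c2) (- c1) (1 - a) Pg1
                  ltac:(lra) (B1 _) (B1 _) ltac:(lra)).
    unfold mismatch. lra. }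
  assert (Minc : forall c1 c2, c1 < c2 -> mismatch c1 < mismatch c2).
  { intros c1 c2 Hc.
    pose proof (branch_compare_strict g0 (h0 c1) (h0 c2) c1 c2 a Pg0 Hc (B0 c1) (B0 c2)
                  ltac:(lra)).
    pose proof (branch_compare g1 (h1 (- c2)) (h1 (- c1)) (- c2) (- c1) (1 - a) Pg1
                  ltac:(lra) (B1 _) (B1 _) ltac:(lra)).
    unfold mismatch. lra. }
  assert (Mcont : continuity mismatch).
  { apply continuous_continuity. intros c. apply continuous_eps. intros eps He.
    exists eps; split; [exact He|]. intros y Hy. apply Rabs_def2 in Hy.
    destruct (Rle_dec c y) as [L|L].
    - specialize (Mlip c y L). apply Rabs_def1; lra.
    - specialize (Mlip y c ltac:(lra)). apply Rabs_def1; lra. }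
  (* At [cc] the upper line of the left branch meets the lower line of the right branch above [a];
     at [ch] the roles are exchanged. *)
  assert (Mcc : mismatch cc <= 0).
  { unfold mismatch. pose proof (H0 cc a). pose proof (H1 (- cc) (1 - a)). nra. }
  assert (Mch : 0 <= mismatch ch).
  { unfold mismatch. pose proof (H0 ch a). pose proof (H1 (- ch) (1 - a)). nra. }
  assert (Hcch : cc <= ch).
  { destruct (Rle_dec cc ch) as [|L]; [assumption|]. specialize (Minc ch cc ltac:(lra)). lra. }
  destruct (IVT_gen mismatch cc ch 0 Mcont) as [cs [Hcs Ecs]].
  { rewrite Rmin_left, Rmax_right by lra. lra. }
  rewrite Rmin_left, Rmax_right in Hcs by lra.
  (* At speed 0 energy is conserved: half the squared heights of the branches at [a] are
     [- RInt f0 0 a] and [RInt f1 a 1], and the first is smaller by [hint]. *)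
  assert (M0 : mismatch 0 < 0).
  { destruct (branch_energy g0 (h0 0) 0 a Cg0 (B0 0) ltac:(lra)) as [e0 [_ E0]].
    pose proof (B1 0) as B1'.
    destruct (branch_energy g1 (h1 0) 0 (1 - a) Cg1 B1' ltac:(lra)) as [e1 [_ E1]].
    assert (I0 : RInt f0 0 a = - RInt (fun s => g0 s * s) 0 a).
    { rewrite <- (RInt_opp (V := R_CompleteNormedModule) (fun s => g0 s * s)).
      - apply RInt_ext. intros x Hx. rewrite Rmin_left, Rmax_right in Hx by lra.
        unfold opp; simpl. apply Ef0. lra.
      - apply (ex_RInt_continuous (V := R_CompleteNormedModule)).
        intros; now apply weighted_continuous. }
    assert (Cw : forall x, continuous (fun s => g1 s * s) x)
      by (intros; now apply weighted_continuous).
    assert (X1 : forall x y, ex_RInt (fun s => g1 s * s) x y)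
      by (intros; apply (ex_RInt_continuous (V := R_CompleteNormedModule)); intros; apply Cw).
    assert (I1 : RInt f1 a 1 = RInt (fun s => g1 s * s) 0 (1 - a)).
    { pose proof (RInt_comp_lin (V := R_CompleteNormedModule) (fun s => g1 s * s)
                    (-1) 1 a 1 (X1 _ _)) as E.
      replace (-1 * a + 1) with (1 - a) in E by ring.
      replace (-1 * 1 + 1) with 0 in E by ring.
      rewrite <- (opp_RInt_swap (V := R_CompleteNormedModule) (fun s => g1 s * s) 0 (1 - a))
        in E by apply X1.
      rewrite (RInt_ext _ (fun y => opp (f1 y))) in E.
      - rewrite (RInt_opp (V := R_CompleteNormedModule) f1) in E.
        + unfold opp in E; simpl in E. lra.
        + apply (ex_RInt_ext (fun y => g1 (1 - y) * (1 - y))).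
          * intros x Hx. rewrite Rmin_left, Rmax_right in Hx by lra. rewrite Ef1; lra.
          * apply (ex_RInt_continuous (V := R_CompleteNormedModule)). intros x _.
            apply (continuous_comp (fun y => 1 - y) (fun s => g1 s * s)); [|apply Cw].
            eapply is_derive_continuous. auto_derive; [easy|reflexivity].
      - intros x Hx. rewrite Rmin_left, Rmax_right in Hx by lra.
        unfold scal, opp; simpl; unfold mult; simpl. rewrite Ef1 by lra.
        replace (-1 * x + 1) with (1 - x) by ring. ring. }
    rewrite I0, I1 in hint. unfold mismatch. rewrite Ropp_0.
    assert (P0 : 0 < a * h0 0 a) by (apply Rmult_lt_0_compat; [lra|apply B0]).
    assert (P1 : 0 < (1 - a) * h1 0 (1 - a)) by (apply Rmult_lt_0_compat; [lra|apply B1]).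
    set (p := a * h0 0 a) in *. set (q := (1 - a) * h1 0 (1 - a)) in *. nra. }
  assert (Pcs : 0 < cs).
  { destruct (Rlt_dec 0 cs) as [|L]; [assumption|].
    pose proof (Mlip cs 0 ltac:(lra)). lra. }
  assert (Profile : forall c u, 0 < c -> travelling_wave a (glue a f0 f1) c u ->
    (forall z, z <= 0 -> 0 < u z <= a /\ Derive u z = u z * h0 c (u z)) /\
    (forall z, 0 <= z -> a <= u z < 1 /\ Derive u z = (1 - u z) * h1 (- c) (1 - u z))).
  { intros c u Hc T.
    apply (wave_profile a c (Lam (- alpha_inf a f0) c) (Lam (- beta_inf a f1) (- c))
             (- alpha_inf a f0) (- beta_inf a f1) f0 f1 g0 g1); auto.
    - intros x. split; [apply Pg0|apply Bg0].
    - intros x. split; [apply Pg1|apply Bg1].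
    - intros x. apply H0.
    - intros x. apply H1. }
  destruct (wave_exists a cs f0 f1 g0 g1 (h0 cs) (h1 (- cs))) as [us Tus]; auto.
  { unfold mismatch in Ecs. lra. }
  exists cs, us. split; [exact Pcs|]. split; [exact Tus|]. split; [|exact Hcs].
  intros c u Hc T.
  assert (Ec : c = cs).
  { assert (Mc : mismatch c = 0).
    { destruct (Profile c u Hc T) as [HL HR].
      destruct (HL 0 ltac:(lra)) as [_ E0]. destruct (HR 0 ltac:(lra)) as [_ E1].
      rewrite (tw_origin _ _ _ _ T) in E0, E1. unfold mismatch. lra. }
    destruct (Rtotal_order c cs) as [L|[L|L]]; [|exact L|]; apply Minc in L; lra. }
  subst c. split; [reflexivity|].
  apply (wave_unique a (h0 cs) (h1 (- cs))); try apply B0; try apply B1; [exact ha| |].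
  { unfold mismatch in Ecs. lra. }
  intros w Hw.
  assert (Tw : travelling_wave a (glue a f0 f1) cs w) by (now destruct Hw as [-> | ->]).
  split; [apply (wave_derivatives _ _ _ _ Tw)|].
  split; [apply (tw_origin _ _ _ _ Tw)|]. now apply Profile.
Qed.
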